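(* Let $n\ge 2$ be an integer. Consider the differential system, for unknown functions $z\mapsto (r(z),\theta(z))$, \[ \frac{dr}{dz} = -\tan\theta,\qquad \frac{d\theta}{dz} = (n-1)\Bigl(\frac{z}{\cos\theta}-\frac{1}{r}\Bigr), \] with values in the domain $r>0$, $\theta\in(-\pi/2,\pi/2)$. There exists a unique solution $z\mapsto (r(z),\theta(z))$ of this system that is defined on the whole interval $(0,+\infty)$. Moreover, this solution satisfies $r(z)\sim 1/z$ and $\theta(z)\to 0$ as $z\to+\infty$.
   Context: This system is the axisymmetric capillary equation $(n-1)\frac{\cos\theta}{r}+\cos\theta\,\frac{d\theta}{dz}=\kappa z$ with $\kappa=n-1$, for a hypersurface of $\mathbb{R}^{n+1}$ axisymmetric about the $z$-axis, where $r$ is the distance to the axis and $\theta$ is the angle of the profile curve. *)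

(* Defs.v *)
From Stdlib Require Import Reals Lra.
From Coquelicot Require Import Coquelicot.
Open Scope R_scope.

Definition capillary_solution (n : nat) (r theta : R -> R) : Prop :=
  forall z : R, 0 < z ->
    0 < r z /\ - (PI / 2) < theta z < PI / 2 /\
    is_derive r z (- tan (theta z)) /\
    is_derive theta z ((INR n - 1) * (z / cos (theta z) - 1 / r z)).

(* Main.v *)
(* Put [u = sin theta], [rho = z r] and [m = n - 1 = p + 1]. The flux
   [r^m cos theta - m/(m+1) z r^(m+1)] decreases; a global solution keeps it
   positive, since otherwise [u' >= z / 2] eventually, and conversely a solution
   started with positive flux extends down to every positive height. In the
   variables [(rho, u)] the system is, in the time [z^2 / 2], an [O(z^-2)]
   perturbation of the Hamiltonian flow of Delaunay profiles, whose Hamiltonian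
   [rho^m cos theta - m/(m+1) rho^(m+1)] is maximal at the cylinder [rho = 1],
   [u = 0]. Virial corrections such as [rho^(m+1) u / z^2] turn the Hamiltonian
   into a Lyapunov function, which shows that a global solution returns
   arbitrarily close to the cylinder and then that it satisfies
   [rho = 1 + O(z^-3)] and [u = z^-2 + O(z^-3)]. With this precision the squared
   distance of two solutions, multiplied by [z], is nondecreasing in [z]. Hence
   two global solutions coincide, and the solutions started at height [b] from
   [rho = 1], [u = b^-2] converge as [b] tends to infinity. *)
Require Import Defs.
From Stdlib Require Import Reals PSeries_reg Lra Lia Psatz IndefiniteDescription.
From Coquelicot Require Import Coquelicot.
Open Scope R_scope.

(** In the time [z^2 / 2] the linearisation at the cylinder is a centre, so no exponential dichotomy
    singles out the global solution. Only the drift of relative order [z^-2], created by the scaling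
    [rho = z r], can do so, and the virial terms expose its sign. Decay estimates run downwards: the
    size at height [a] is controlled by the gap at any larger height [b] plus an error in powers of
    [1 / a]. So closeness to the cylinder along some unbounded set of heights suffices for a global
    solution, and the explicit data at [b] suffice for a shot one, with constants independent of
    [b]. Two rounds are needed. Knowing [rho - 1] and [u] only up to [O(z^-2)], the derivative of
    the squared distance [E] of two solutions has a term of size [E / z] with an uncontrolled
    constant; the weight [z^N] that absorbs it is too large against [E = O(z^-4)]. Precision
    [O(z^-3)] around [u = z^-2] makes that term negligible: the weight [z] is enough, while
    [E = O(z^-6)]. *)

Lemma nondecr_of_derive (f df : R -> R) (a b : R) :
  a <= b ->
  (forall z, a <= z <= b -> is_derive f z (df z)) ->
  (forall z, a <= z <= b -> 0 <= df z) ->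
  f a <= f b.
Proof.
intros hab hd hp.
destruct (MVT_gen f a b df) as [c [hc he]].
- intros x hx. rewrite Rmin_left, Rmax_right in hx by lra. apply hd; lra.
- intros x hx. rewrite Rmin_left, Rmax_right in hx by lra.
  apply derivable_continuous_pt. exists (df x). apply is_derive_Reals, hd; lra.
- rewrite Rmin_left, Rmax_right in hc by lra.
  assert (h := hp c hc). nra.
Qed.

Lemma le_div_intro (a b c : R) : 0 < c -> a * c <= b -> a <= b / c.
Proof. intros hc. exact (proj1 (Rle_div_r a b c hc)). Qed.

Lemma div_le_intro (a b c : R) : 0 < c -> a <= b * c -> a / c <= b.
Proof. intros hc. exact (proj2 (Rle_div_l a b c hc)). Qed.

Lemma pow_le_pow2 (x : R) (k : nat) : 0 <= x <= 2 -> 0 <= x ^ k <= 2 ^ k.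
Proof. intros hx; split; [apply pow_le | apply pow_incr]; lra. Qed.

Lemma pow_sub1_le (k : nat) (x : R) : 0 <= x <= 2 -> Rabs (x ^ k - 1) <= 2 ^ k * Rabs (x - 1).
Proof.
intros hx.
assert (h : Rabs (x ^ k - 1) <= (2 ^ k - 1) * Rabs (x - 1)).
{ induction k as [|k IH]; simpl.
  - rewrite !Rminus_diag, Rabs_R0. lra.
  - replace (x * x ^ k - 1) with (x * (x ^ k - 1) + (x - 1)) by ring.
    eapply Rle_trans; [apply Rabs_triang|]. rewrite Rabs_mult, (Rabs_pos_eq x) by lra.
    assert (h0 := Rabs_pos (x ^ k - 1)). nra. }
assert (h1 := Rabs_pos (x - 1)). nra.
Qed.

(* The increment from [p] to [p + 1] is [(p + 2) x^(p+1) (x - 1)^2]. *)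
Lemma hump_ge (p : nat) (x : R) : 0 <= x ->
  (x - 1) ^ 2 <= 1 - (INR p + 2) * x ^ S p + (INR p + 1) * x ^ S (S p).
Proof.
intros hx. induction p as [|p IH].
- simpl; nra.
- rewrite S_INR. assert (h := pow_le x (S p) hx). assert (h1 := pos_INR p).
  assert (h2 : 0 <= (INR p + 2) * x ^ S p * (x - 1) ^ 2).
  { apply Rmult_le_pos; [nra | apply pow2_ge_0]. }
  simpl in *. nra.
Qed.

(** Same induction as for [hump_ge], with the increment bounded through [x <= 2], the range to which
    positive flux confines [rho]. It bounds the gap of the Hamiltonian from above near the
    cylinder. *)
Lemma hump_le (p : nat) : exists C, 0 < C /\ forall x, 0 <= x <= 2 ->
  1 - (INR p + 2) * x ^ S p + (INR p + 1) * x ^ S (S p) <= C * (x - 1) ^ 2.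
Proof.
induction p as [|p [C [hC IH]]].
- exists 1; split; [lra|]. intros x hx; simpl; nra.
- exists (C + (INR p + 2) * 2 ^ S p). assert (h1 := pos_INR p).
  assert (h0 := pow_lt 2 (S p) ltac:(lra)). split; [nra|].
  intros x hx. specialize (IH x hx). rewrite S_INR.
  assert (h := pow_le_pow2 x (S p) hx).
  assert (h2 : (INR p + 2) * x ^ S p * (x - 1) ^ 2 <= (INR p + 2) * 2 ^ S p * (x - 1) ^ 2).
  { apply Rmult_le_compat_r; [apply pow2_ge_0 | nra]. }
  simpl in *. nra.
Qed.

(** * The system in [(r, u)] and its functionals *)

(** This is [cos theta] for [u = sin theta]; the positive root is the right one because theta stays
    in [(-PI/2, PI/2)]. *)
Definition cosine (u : R) : R := sqrt (1 - u ^ 2).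

Lemma cosine_props (u : R) : -1 < u < 1 ->
  0 < cosine u <= 1 /\ cosine u ^ 2 = 1 - u ^ 2 /\ u ^ 2 / 2 <= 1 - cosine u <= u ^ 2.
Proof.
intros hu. assert (hp : 0 < 1 - u ^ 2) by nra.
assert (h1 : 0 < cosine u) by (apply sqrt_lt_R0; lra).
assert (h2 : cosine u ^ 2 = 1 - u ^ 2) by (apply pow2_sqrt; lra).
assert (h3 : cosine u <= 1) by nra.
repeat split; nra.
Qed.

(* The profile equations in the unknowns [r] and [u = sin theta]. *)
Definition profile (p : nat) (r u : R -> R) (z : R) : Prop :=
  0 < r z /\ -1 < u z < 1 /\
  is_derive r z (- (u z / cosine (u z))) /\
  is_derive u z ((INR p + 1) * (z - cosine (u z) / r z)).

(** Up to a constant factor, the vertical force through the section at height [z]: surface tension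
    along its boundary minus pressure on the section. *)
Definition flux (p : nat) (r u : R -> R) (z : R) : R :=
  r z ^ S p * cosine (u z) - (INR p + 1) / (INR p + 2) * (z * r z ^ S (S p)).

Definition unduloid (p : nat) (x u : R) : R :=
  x ^ S p * cosine u - (INR p + 1) / (INR p + 2) * x ^ S (S p).

Definition lyap (p : nat) (r u : R -> R) (z : R) : R :=
  unduloid p (z * r z) (u z) + (z * r z) ^ S (S p) * u z / z ^ 2.

Lemma is_derive_pow_S (f : R -> R) (k : nat) (z l : R) :
  is_derive f z l -> is_derive (fun x => f x ^ S k) z ((INR k + 1) * l * f z ^ k).
Proof. intros h. rewrite <- S_INR. exact (is_derive_pow f (S k) z l h). Qed.

Lemma is_derive_cosine (u : R -> R) (z l : R) : -1 < u z < 1 -> is_derive u z l ->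
  is_derive (fun x => cosine (u x)) z (- (u z * l / cosine (u z))).
Proof.
intros hu h. destruct (cosine_props _ hu) as [h1 [h2 h3]]. unfold cosine in *.
auto_derive.
- split; [eexists; exact h|]. split; [|trivial]. nra.
- replace (Derive (fun x => u x) z) with l by (symmetry; exact (is_derive_unique _ _ _ h)).
  replace (1 + - (u z * (u z * 1))) with (1 - u z ^ 2) by ring. field. lra.
Qed.

Lemma is_derive_rho (p : nat) (r u : R -> R) (z : R) : profile p r u z ->
  is_derive (fun x => x * r x) z (r z - z * (u z / cosine (u z))).
Proof.
intros [hr [hu [dr du]]]. auto_derive; [eexists; exact dr|].
replace (Derive (fun x => r x) z) with (- (u z / cosine (u z)))
  by (symmetry; exact (is_derive_unique _ _ _ dr)). ring.
Qed.

Lemma is_derive_ext_val (f : R -> R) (z l l' : R) : l = l' -> is_derive f z l -> is_derive f z l'.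
Proof. now intros <-. Qed.

Ltac derive_val h := match type of h with is_derive ?f ?z ?l =>
  replace (Derive (fun x => f x) z) with l by (symmetry; exact (is_derive_unique _ _ _ h)) end.
Ltac derive_side := repeat (match goal with |- _ /\ _ => split end); try (eexists; eassumption); try trivial.


(** With the pressure held constant this is the first integral of Delaunay profiles, so all terms
    cancel except the one where the explicit factor [z] is differentiated. *)
Lemma is_derive_flux (p : nat) (r u : R -> R) (z : R) : profile p r u z ->
  is_derive (flux p r u) z (- ((INR p + 1) / (INR p + 2) * r z ^ S (S p))).
Proof.
intros [hr [hu [dr du]]]. destruct (cosine_props _ hu) as [h1 [h2 h3]].
assert (hp := pos_INR p).
(* The powers and the cosine enter as abstract functions, so that [auto_derive] only performs the
   product rule and leaves them folded. *)
assert (key : forall Q S c : R -> R, forall q s d, is_derive Q z q -> is_derive S z s ->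
  is_derive c z d -> forall k, is_derive (fun x => Q x * c x - k * (x * S x)) z
    (q * c z + Q z * d - k * (S z + z * s))).
{ intros Q S c q s d dQ dS dc k. auto_derive; [derive_side|].
  derive_val dQ. derive_val dS. derive_val dc. ring. }
eapply is_derive_ext_val; [|exact (key _ _ _ _ _ _ (is_derive_pow_S r p z _ dr)
  (is_derive_pow_S r (S p) z _ dr) (is_derive_cosine u z _ hu du) _)].
rewrite S_INR. cbv beta. simpl pow. simpl pow in h2.
generalize (r z ^ p). intros P. revert h1 h2.
generalize (cosine (u z)). intros c h1 h2.
apply (Rmult_eq_reg_r c); [|lra]. field_simplify; lra.
Qed.

(** Write [x = z r], [c = cos theta]. The drift [x / z] in the equation of [x] adds
    [(p+1) x^(p+1) (c - x) / z] to the derivative of the Hamiltonian, which has no sign.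
    Differentiating [u] in the virial term gives exactly the opposite, and differentiating its power
    of [x] leaves a dissipation in [u^2]. *)
Lemma is_derive_lyap (p : nat) (r u : R -> R) (z : R) : 0 < z -> profile p r u z ->
  is_derive (lyap p r u) z
    (- ((INR p + 2) * (z * r z) ^ S p * u z ^ 2 / (cosine (u z) * z))
     + INR p * (z * r z) ^ S (S p) * u z / z ^ 3).
Proof.
intros hz hpr. assert (dx := is_derive_rho p r u z hpr).
destruct hpr as [hr [hu [dr du]]]. destruct (cosine_props _ hu) as [h1 [h2 h3]].
assert (hp := pos_INR p).
assert (key : forall Q S c : R -> R, forall q s d v, is_derive Q z q -> is_derive S z s ->
  is_derive c z d -> is_derive u z v -> forall k,
  is_derive (fun x => Q x * c x - k * S x + S x * u x / x ^ 2) z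
    (q * c z + Q z * d - k * s + s * u z / z ^ 2 + S z * v / z ^ 2 - 2 * S z * u z / z ^ 3)).
{ intros Q S c q s d v dQ dS dc dv k. auto_derive; [derive_side; nra|].
  derive_val dQ. derive_val dS. derive_val dc. derive_val dv. field. lra. }
eapply is_derive_ext_val; [|exact (key _ _ _ _ _ _ _ (is_derive_pow_S _ p z _ dx)
  (is_derive_pow_S _ (S p) z _ dx) (is_derive_cosine u z _ hu du) du _)].
rewrite S_INR. cbv beta. rewrite <- !tech_pow_Rmult.
generalize ((z * r z) ^ p). intros P. revert h1 h2.
generalize (cosine (u z)). intros c h1 h2.
apply (Rmult_eq_reg_r (c * z ^ 3)); [|apply Rgt_not_eq, Rmult_lt_0_compat; [lra | apply pow_lt; lra]].
field_simplify; try lra.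
replace (u z ^ 2) with (1 - c ^ 2) by lra. field; lra.
Qed.

(** * Monotonicity and positivity of the flux *)

Lemma flux_decr (p : nat) (r u : R -> R) (a b : R) : a <= b ->
  (forall z, a <= z <= b -> profile p r u z) ->
  flux p r u b <= flux p r u a.
Proof.
intros hab hs. apply Ropp_le_cancel.
apply (nondecr_of_derive (fun z => - flux p r u z)
  (fun z => (INR p + 1) / (INR p + 2) * r z ^ S (S p))); [exact hab | |].
- intros z hz. assert (d := is_derive_opp _ _ _ (is_derive_flux p r u z (hs z hz))).
  eapply is_derive_ext_val; [|exact d]. apply Ropp_involutive.
- intros z hz. destruct (hs z hz) as [hr _]. assert (hp := pos_INR p).
  apply Rmult_le_pos; [|apply pow_le; lra]. apply Rdiv_le_0_compat; lra.
Qed.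

Lemma flux_lt (p : nat) (r u : R -> R) (a b : R) : a < b ->
  (forall z, a <= z <= b -> profile p r u z) ->
  flux p r u b < flux p r u a.
Proof.
intros hab hs.
destruct (MVT_gen (flux p r u) a b (fun z => - ((INR p + 1) / (INR p + 2) * r z ^ S (S p))))
  as [c [hc he]].
- intros x hx. rewrite Rmin_left, Rmax_right in hx by lra. apply is_derive_flux, hs; lra.
- intros x hx. rewrite Rmin_left, Rmax_right in hx by lra.
  apply derivable_continuous_pt. eexists. apply is_derive_Reals, is_derive_flux, hs; lra.
- rewrite Rmin_left, Rmax_right in hc by lra. destruct (hs c hc) as [hr _].
  assert (hp := pos_INR p).
  assert (h : 0 < (INR p + 1) / (INR p + 2) * r c ^ S (S p)).
  { apply Rmult_lt_0_compat; [apply Rdiv_lt_0_compat; lra | apply pow_lt; lra]. }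
  nra.
Qed.

Lemma flux_split (p : nat) (r u : R -> R) (z : R) :
  flux p r u z = r z ^ S p * (cosine (u z) - (INR p + 1) / (INR p + 2) * (z * r z)).
Proof. unfold flux. simpl. ring. Qed.

(* If the flux became negative, [r] would stay above [2 / z], so that
   [u' >= z / 2] and [u] would leave [(-1, 1)]. *)
Lemma flux_pos (p : nat) (r u : R -> R) :
  (forall z, 0 < z -> profile p r u z) -> forall z, 0 < z -> 0 < flux p r u z.
Proof.
intros hs z1 hz1. apply Rnot_le_lt. intros hF. assert (hp := pos_INR p).
assert (hlt := flux_lt p r u z1 (z1 + 1) ltac:(lra) (fun z h => hs z ltac:(lra))).
set (f := - flux p r u (z1 + 1)). assert (hf : 0 < f) by (unfold f; lra).
(* From here on [flux <= - f] forces [z r >= 2]: it gives [f <= z r^(p+2)], hence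
   [f z <= (z r)^(p+2)], and [f z] exceeds [2^(p+2)] beyond [z3]. *)
set (z3 := z1 + 2 + 2 ^ S (S p) / f).
assert (h2 : 0 < 2 ^ S (S p) / f) by (apply Rdiv_lt_0_compat; [apply pow_lt; lra | exact hf]).
assert (big : forall z, z3 <= z -> 2 <= z * r z).
{ intros z hz. apply Rnot_lt_le. intros hlt2.
  assert (hz0 : z1 + 2 < z) by (unfold z3 in hz; lra).
  destruct (hs z ltac:(lra)) as [hr [hu _]]. destruct (cosine_props _ hu) as [hc _].
  assert (hd := flux_decr p r u (z1 + 1) z ltac:(lra) (fun y h => hs y ltac:(lra))).
  assert (e : z * r z ^ S (S p) * z ^ S p = (z * r z) ^ S (S p)).
  { rewrite Rpow_mult_distr. simpl. ring. }
  assert (l1 : f <= z * r z ^ S (S p)).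
  { unfold flux in hd at 1. fold f in hd.
    assert (h0 := pow_lt (r z) (S p) hr). assert (h0' := pow_lt (r z) (S (S p)) hr).
    assert (hk : 0 < (INR p + 1) / (INR p + 2) <= 1).
    { split; [apply Rdiv_lt_0_compat; lra | apply div_le_intro; lra]. }
    assert (hX : 0 < z * r z ^ S (S p)) by nra.
    assert (h6 : 0 < r z ^ S p * cosine (u z)) by nra.
    unfold f. nra. }
  assert (l2 : (z * r z) ^ S (S p) <= 2 ^ S (S p)) by (apply pow_incr; nra).
  assert (l3 : z <= z ^ S p).
  { simpl. assert (h5 := pow_R1_Rle z p ltac:(lra)). nra. }
  assert (l4 : 2 ^ S (S p) < f * z).
  { replace (2 ^ S (S p)) with (f * (2 ^ S (S p) / f)) by (field; lra).
    apply Rmult_lt_compat_l; [lra|]. unfold z3 in hz. lra. }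
  rewrite <- e in l2. nra. }
(* Over a length 4 the slope [1 / 2] makes [u] gain 2, which is the full width of the open interval
   [(-1, 1)]. *)
assert (hm : u z3 - z3 / 2 <= u (z3 + 4) - (z3 + 4) / 2).
{ apply (nondecr_of_derive (fun z => u z - z / 2)
    (fun z => (INR p + 1) * (z - cosine (u z) / r z) - / 2)); [lra | |].
  - intros z hz. destruct (hs z ltac:(unfold z3 in hz; lra)) as [_ [_ [_ du]]].
    auto_derive; [eexists; exact du|]. derive_val du. lra.
  - intros z hz. specialize (big z ltac:(lra)).
    destruct (hs z ltac:(unfold z3 in hz; lra)) as [hr [hu _]].
    destruct (cosine_props _ hu) as [hc _].
    assert (h : cosine (u z) / r z <= z / 2).
    { apply div_le_intro; [lra|]. nra. }
    unfold z3 in hz. nra. }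
destruct (hs z3 ltac:(unfold z3; lra)) as [_ [hu1 _]].
destruct (hs (z3 + 4) ltac:(unfold z3; lra)) as [_ [hu2 _]]. lra.
Qed.

(** The second factor in [flux_split] must be positive, and [(p+1)/(p+2) >= 1/2] makes the bound
    uniform in [p]. *)
Lemma rho_le_cosine (p : nat) (r u : R -> R) (z : R) : 0 < z -> profile p r u z ->
  0 < flux p r u z -> 0 < z * r z <= 2 * cosine (u z).
Proof.
intros hz [hr [hu _]] hF. assert (hp := pos_INR p). split; [nra|].
rewrite flux_split in hF. assert (h := pow_lt (r z) (S p) hr).
assert (h1 : 0 < cosine (u z) - (INR p + 1) / (INR p + 2) * (z * r z)).
{ apply (Rmult_lt_reg_l (r z ^ S p)); lra. }
assert (hk : 1 / 2 <= (INR p + 1) / (INR p + 2)) by (apply le_div_intro; lra).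
assert (h2 : 0 < z * r z) by nra.
assert (h3 := Rmult_le_compat_r _ _ _ (Rlt_le _ _ h2) hk). lra.
Qed.

Lemma rho_le2 (p : nat) (r u : R -> R) (z : R) : 0 < z -> profile p r u z ->
  0 < flux p r u z -> 0 < z * r z <= 2.
Proof.
intros hz hs hF. assert (h := rho_le_cosine p r u z hz hs hF).
destruct hs as [_ [hu _]]. destruct (cosine_props _ hu). lra.
Qed.

(** A lower bound on the flux keeps a solution away from both boundaries [r = 0] and
    [cos theta = 0]: the flux is at most [r^(p+1) cos theta], so each factor is at least the flux
    divided by a bound for the others. *)
Lemma flux_region (p : nat) (r u : R -> R) (a z f : R) : 0 < a <= z -> profile p r u z ->
  0 < f <= flux p r u z ->
  f <= r z * (2 / a) ^ p /\ f <= cosine (u z) * (2 / a) ^ S p.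
Proof.
intros ha hs hf. assert (h := rho_le2 p r u z ltac:(lra) hs ltac:(lra)).
destruct hs as [hr [hu _]]. destruct (cosine_props _ hu) as [hc _].
assert (hp := pos_INR p).
assert (hR : r z <= 2 / a) by (apply le_div_intro; nra).
assert (hF : flux p r u z <= r z ^ S p * cosine (u z)).
{ unfold flux. assert (0 <= (INR p + 1) / (INR p + 2) * (z * r z ^ S (S p))); [|lra].
  apply Rmult_le_pos; [apply Rdiv_le_0_compat; lra|].
  apply Rmult_le_pos; [lra | apply pow_le; lra]. }
assert (h1 := pow_incr (r z) (2 / a) p ltac:(lra)).
assert (h2 := pow_incr (r z) (2 / a) (S p) ltac:(lra)).
assert (h3 := pow_le (r z) p ltac:(lra)).
assert (h4 := pow_le (r z) (S p) ltac:(lra)).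
split; simpl in *; nra.
Qed.

(** * The Lyapunov function: coercivity and decay *)

(** [1 / (p+2)] is the value at the cylinder. Both summands are nonnegative, by [hump_ge] and
    [cosine <= 1]; this is the maximality of the Hamiltonian there. *)
Lemma unduloid_gap (p : nat) (x u : R) : 1 / (INR p + 2) - unduloid p x u =
  (1 - (INR p + 2) * x ^ S p + (INR p + 1) * x ^ S (S p)) / (INR p + 2) + x ^ S p * (1 - cosine u).
Proof. unfold unduloid. assert (hp := pos_INR p). field. lra. Qed.

(** Young's inequality splits the virial term: half of the [u^2] part of the gap absorbs one piece,
    the other is [O(z^-4)] since [rho <= 2]. *)
Lemma lyap_coercive (p : nat) (r u : R -> R) (z d : R) : 0 < z ->
  0 < z * r z <= 2 -> -1 < u z < 1 -> 1 / (INR p + 2) - lyap p r u z <= d ->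
  (z * r z - 1) ^ 2 / (INR p + 2) + (z * r z) ^ S p * u z ^ 2 / 4 <= d + 4 * 2 ^ S p / z ^ 4.
Proof.
intros hz hx hu h. assert (hp := pos_INR p). destruct (cosine_props _ hu) as [hc [_ hc2]].
unfold lyap in h. assert (hg := unduloid_gap p (z * r z) (u z)).
revert hx h hg. generalize (z * r z). intros x hx h hg.
assert (h1 := hump_ge p x ltac:(lra)).
assert (h2 : (x - 1) ^ 2 / (INR p + 2) <=
  (1 - (INR p + 2) * x ^ S p + (INR p + 1) * x ^ S (S p)) / (INR p + 2)).
{ apply Rmult_le_compat_r; [apply Rlt_le, Rinv_0_lt_compat; lra | exact h1]. }
assert (hQ := pow_le_pow2 x (S p) ltac:(lra)).
assert (h3 : x ^ S p * (u z ^ 2 / 2) <= x ^ S p * (1 - cosine (u z))) by (apply Rmult_le_compat_l; lra).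
assert (h4 : x ^ S (S p) * u z / z ^ 2 <= x ^ S p * u z ^ 2 / 4 + 4 * 2 ^ S p / z ^ 4).
{ assert (h5 : x ^ S p * (x * u z / z ^ 2) <= x ^ S p * (u z ^ 2 / 4 + 4 / z ^ 4)).
  { apply Rmult_le_compat_l; [lra|].
    assert (h6 : (x / z ^ 2) ^ 2 <= 4 / z ^ 4).
    { replace ((x / z ^ 2) ^ 2) with (x ^ 2 / z ^ 4) by (field; lra).
      apply Rmult_le_compat_r; [apply Rlt_le, Rinv_0_lt_compat, pow_lt; lra | nra]. }
    replace (x * u z / z ^ 2) with (u z * (x / z ^ 2)) by (field; lra).
    assert (h7 := pow2_ge_0 (u z / 2 - x / z ^ 2)). lra. }
  assert (h7 : x ^ S p * (4 / z ^ 4) <= 2 ^ S p * (4 / z ^ 4)).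
  { apply Rmult_le_compat_r; [apply Rdiv_le_0_compat; [lra | apply pow_lt; lra] | lra]. }
  replace (x ^ S (S p) * u z / z ^ 2) with (x ^ S p * (x * u z / z ^ 2)) by (simpl; field; lra).
  replace (4 * 2 ^ S p / z ^ 4) with (2 ^ S p * (4 / z ^ 4)) by (field; lra). lra. }
lra.
Qed.

(** One copy of the dissipation absorbs, by Young, the indefinite term of [is_derive_lyap] up to
    [C / z^5], whose integral is at most [C / (4 a^4)]. *)
Lemma lyap_decay (p : nat) (r u : R -> R) (a b : R) : 0 < a <= b ->
  (forall z, a <= z <= b -> profile p r u z /\ 0 < flux p r u z) ->
  lyap p r u b <= lyap p r u a + INR p ^ 2 * 2 ^ S p / a ^ 4.
Proof.
intros ha hs. assert (hp := pos_INR p). set (C := INR p ^ 2 * 2 ^ S p).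
assert (hC : 0 <= C) by (apply Rmult_le_pos; [nra | apply pow_le; lra]).
assert (h : - lyap p r u a - C / 4 * / a ^ 4 <= - lyap p r u b - C / 4 * / b ^ 4).
{ apply (nondecr_of_derive (fun z => - lyap p r u z - C / 4 * / z ^ 4)
    (fun z => (INR p + 2) * (z * r z) ^ S p * u z ^ 2 / (cosine (u z) * z)
     - INR p * (z * r z) ^ S (S p) * u z / z ^ 3 + C / z ^ 5)); [lra | |].
  - intros z hz. destruct (hs z hz) as [hpr _].
    assert (d := is_derive_lyap p r u z ltac:(lra) hpr).
    auto_derive.
    + split; [eexists; exact d|]. split; [|trivial].
      assert (0 < z ^ 4) by (apply pow_lt; lra). simpl in *. lra.
    + derive_val d. destruct (cosine_props (u z)) as [h1 _]; [apply hpr|]. field; lra.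
  - intros z hz. destruct (hs z hz) as [hpr hF].
    assert (hx := rho_le2 p r u z ltac:(lra) hpr hF).
    destruct hpr as [_ [hu _]]. destruct (cosine_props _ hu) as [hc _].
    revert hx. generalize (z * r z). intros x hx.
    assert (hQ := pow_le_pow2 x (S p) ltac:(lra)).
    assert (h1 : x ^ S p * u z ^ 2 / z <= x ^ S p * u z ^ 2 / (cosine (u z) * z)).
    { apply Rmult_le_compat_l; [assert (0 <= u z ^ 2) by apply pow2_ge_0; nra|].
      apply Rinv_le_contravar; nra. }
    assert (h2 : INR p * x ^ S (S p) * u z / z ^ 3 <= x ^ S p * u z ^ 2 / z + C / z ^ 5).
    { unfold C.
      replace (INR p * x ^ S (S p) * u z / z ^ 3)
        with (x ^ S p / z * (u z * (INR p * x / z ^ 2))) by (simpl; field; lra).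
      replace (x ^ S p * u z ^ 2 / z + INR p ^ 2 * 2 ^ S p / z ^ 5)
        with (x ^ S p / z * (u z ^ 2) + 2 ^ S p / z * (INR p ^ 2 * 1 / z ^ 4)) by (field; lra).
      assert (h3 : u z * (INR p * x / z ^ 2) <= u z ^ 2 + INR p ^ 2 * 1 / z ^ 4).
      { assert (h4 : (INR p * x / z ^ 2) ^ 2 <= 4 * (INR p ^ 2 * 1 / z ^ 4)).
        { replace ((INR p * x / z ^ 2) ^ 2) with (x ^ 2 * (INR p ^ 2 * 1 / z ^ 4)) by (field; lra).
          apply Rmult_le_compat_r; [|nra]. apply Rdiv_le_0_compat; [nra | apply pow_lt; lra]. }
        assert (h5 := pow2_ge_0 (u z - INR p * x / z ^ 2 / 2)). lra. }
      assert (h5 : 0 <= x ^ S p / z) by (apply Rdiv_le_0_compat; lra).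
      assert (h6 : x ^ S p / z <= 2 ^ S p / z).
      { apply Rmult_le_compat_r; [apply Rlt_le, Rinv_0_lt_compat; lra | lra]. }
      assert (h7 : 0 <= INR p ^ 2 * 1 / z ^ 4) by (apply Rdiv_le_0_compat; [nra | apply pow_lt; lra]).
      assert (h8 := Rmult_le_compat_l _ _ _ h5 h3).
      assert (h9 := Rmult_le_compat_r _ _ _ h7 h6). lra. }
    assert (h8 : 0 <= x ^ S p * u z ^ 2 / z).
    { apply Rdiv_le_0_compat; [|lra]. apply Rmult_le_pos; [lra | apply pow2_ge_0]. }
    replace ((INR p + 2) * x ^ S p * u z ^ 2 / (cosine (u z) * z))
      with ((INR p + 2) * (x ^ S p * u z ^ 2 / (cosine (u z) * z))) by (field; lra).
    nra. }
assert (ha4 : 0 < / a ^ 4) by (apply Rinv_0_lt_compat, pow_lt; lra).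
assert (hb4 : 0 < / b ^ 4) by (apply Rinv_0_lt_compat, pow_lt; lra).
assert (ha0 := Rmult_le_pos _ _ hC (Rlt_le _ _ ha4)).
assert (hb0 := Rmult_le_pos _ _ hC (Rlt_le _ _ hb4)).
unfold Rdiv in *. lra.
Qed.

(** * From the coarse rate [z^-2] to the refined rate [z^-3] *)

Lemma Rabs_mult_le (x y a b : R) : Rabs x <= a -> Rabs y <= b -> Rabs (x * y) <= a * b.
Proof.
intros hx hy. rewrite Rabs_mult.
apply Rmult_le_compat; auto using Rabs_pos.
Qed.

Lemma Rabs_le_of_sq (x k : R) : 0 <= k -> x ^ 2 <= k ^ 2 -> Rabs x <= k.
Proof. intros hk h. apply Rabs_le. nra. Qed.

(** The weight [x^(p+1)] degenerates at [x = 0], so the order matters: first [x - 1] is estimated,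
    then [z >= 2 K] yields [x >= 1/2], and only then can the weight be removed from [u^2]. *)
Lemma coarse_small (p : nat) (C : R) : 0 <= C -> exists K, 1 <= K /\
  forall z x u, 2 * K <= z -> 0 < x <= 2 ->
  (x - 1) ^ 2 / (INR p + 2) + x ^ S p * u ^ 2 / 4 <= C / z ^ 4 ->
  Rabs (x - 1) <= K / z ^ 2 /\ Rabs u <= K / z ^ 2.
Proof.
intros hC. assert (hp := pos_INR p). assert (h2p := pow_lt 2 (S p) ltac:(lra)).
set (K := 1 + C * (INR p + 2) + 4 * C * 2 ^ S p). exists K.
assert (hK0 : 0 <= C * (INR p + 2)) by nra. assert (hK2 : 0 <= C * 2 ^ S p) by nra.
assert (hK : 1 <= K) by (unfold K; lra). split; [exact hK|].
intros z x u hz hx h.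
assert (hz2 : 0 < z ^ 2) by (apply pow_lt; lra).
assert (hw : 0 < / z ^ 4) by (apply Rinv_0_lt_compat, pow_lt; lra).
assert (hKz : 0 <= K / z ^ 2) by (apply Rdiv_le_0_compat; lra).
assert (e : (K / z ^ 2) ^ 2 = K ^ 2 * / z ^ 4) by (field; lra).
assert (hQ := pow_lt x (S p) (proj1 hx)).
assert (hu0 : 0 <= x ^ S p * u ^ 2) by (apply Rmult_le_pos; [lra | apply pow2_ge_0]).
assert (h1 : (x - 1) ^ 2 <= C * (INR p + 2) * / z ^ 4).
{ replace ((x - 1) ^ 2) with ((INR p + 2) * ((x - 1) ^ 2 / (INR p + 2))) by (field; lra).
  replace (C * (INR p + 2) * / z ^ 4) with ((INR p + 2) * (C / z ^ 4)) by (field; lra).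
  apply Rmult_le_compat_l; lra. }
assert (hy : Rabs (x - 1) <= K / z ^ 2).
{ apply Rabs_le_of_sq; [exact hKz|]. rewrite e.
  eapply Rle_trans; [exact h1|]. apply Rmult_le_compat_r; [lra|]. unfold K in *. nra. }
split; [exact hy|].
assert (hsmall : K / z ^ 2 <= 1 / 2) by (apply div_le_intro; nra).
assert (hx2 : 1 / 2 <= x) by (apply Rabs_le_between in hy; lra).
assert (hQ2 := pow_incr (1 / 2) x (S p) ltac:(lra)).
assert (e2 : (1 / 2) ^ S p * 2 ^ S p = 1) by (rewrite <- Rpow_mult_distr; replace (1 / 2 * 2) with 1 by field; apply pow1).
assert (h3 : u ^ 2 <= 4 * C * 2 ^ S p * / z ^ 4).
{ assert (h4 : 0 <= (x - 1) ^ 2 / (INR p + 2)) by (apply Rdiv_le_0_compat; [apply pow2_ge_0 | lra]).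
  assert (h5 : x ^ S p * u ^ 2 <= 4 * C * / z ^ 4) by (unfold Rdiv in *; lra).
  assert (h6 : (1 / 2) ^ S p * u ^ 2 <= x ^ S p * u ^ 2) by (apply Rmult_le_compat_r; [apply pow2_ge_0 | lra]).
  assert (h7 : 2 ^ S p * ((1 / 2) ^ S p * u ^ 2) <= 2 ^ S p * (4 * C * / z ^ 4)) by (apply Rmult_le_compat_l; lra).
  replace (u ^ 2) with ((1 / 2) ^ S p * 2 ^ S p * u ^ 2) by (rewrite e2; ring). lra. }
apply Rabs_le_of_sq; [exact hKz|]. rewrite e.
eapply Rle_trans; [exact h3|]. apply Rmult_le_compat_r; [lra|]. unfold K in *. nra.
Qed.

(* [lyap] is maximal, up to higher order, at [rho = 1], [u = z^-2]; the last
   term turns the derivative of the gap into [(p + 2) (u - z^-2)^2 / z] up to [O(z^-7)]. *)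
Definition excess (p : nat) (r u : R -> R) (z : R) : R :=
  1 / (INR p + 2) - lyap p r u z + / z ^ 4 / 2 + (INR p + 4) * (z * r z - 1) / z ^ 4.

(** To complete the square [(p+2) (u - z^-2)^2 / z], the cross term must be [-2 (p+2) u / z^3]. The
    gap supplies [-p], and the motion [-z u] of [rho] in the last term of [excess] supplies
    [-(p+4)]. The [z^-5] terms [-2] and [p+4] then add up to the required [p+2]. *)
Lemma is_derive_excess (p : nat) (r u : R -> R) (z : R) : 0 < z -> profile p r u z ->
  is_derive (excess p r u) z
    ((INR p + 2) / z * (u z - / z ^ 2) ^ 2
     + ((INR p + 2) / z * (u z ^ 2 * ((z * r z) ^ S p / cosine (u z) - 1))
        - INR p / z ^ 3 * (u z * ((z * r z) ^ S (S p) - 1))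
        - (INR p + 4) / z ^ 3 * (u z * (/ cosine (u z) - 1))
        - 3 * (INR p + 4) / z ^ 5 * (z * r z - 1))).
Proof.
intros hz hpr. assert (dl := is_derive_lyap p r u z hz hpr).
assert (dx := is_derive_rho p r u z hpr).
destruct hpr as [hr [hu _]]. destruct (cosine_props _ hu) as [hc _].
assert (hp := pos_INR p).
assert (key : forall L X : R -> R, forall l x, is_derive L z l -> is_derive X z x ->
  is_derive (fun y => 1 / (INR p + 2) - L y + / y ^ 4 / 2 + (INR p + 4) * (X y - 1) / y ^ 4) z
    (- l - 2 / z ^ 5 + (INR p + 4) * x / z ^ 4 - 4 * (INR p + 4) * (X z - 1) / z ^ 5)).
{ intros L X l x dL dX. auto_derive.
  - assert (0 < z ^ 4) by (apply pow_lt; lra). simpl in *. derive_side; lra.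
  - derive_val dL. derive_val dX. field. lra. }
eapply is_derive_ext_val; [|exact (key _ _ _ _ dl dx)].
cbv beta. rewrite <- !tech_pow_Rmult. field. lra.
Qed.

Lemma inv_cosine_le (u : R) : Rabs u <= 1 / 2 ->
  1 <= / cosine u <= 2 /\ Rabs (/ cosine u - 1) <= Rabs u.
Proof.
intros hu. assert (hu' := hu). apply Rabs_le_between in hu'.
destruct (cosine_props u ltac:(lra)) as [hc [_ hc2]].
assert (ha : u ^ 2 = Rabs u ^ 2) by (rewrite pow2_abs; reflexivity).
assert (h0 := Rabs_pos u).
assert (h1 : 3 / 4 <= cosine u) by nra.
assert (hi : / cosine u * cosine u = 1) by (field; lra).
assert (hi0 : 0 < / cosine u) by (apply Rinv_0_lt_compat; lra).
assert (h2 : 1 <= / cosine u <= 2) by nra.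
split; [exact h2|]. rewrite Rabs_pos_eq by lra.
apply (Rmult_le_reg_r (cosine u)); [lra|]. nra.
Qed.

Section NearCylinder.
Local Ltac prep p K z x u hK hz hy hu :=
  assert (hp := pos_INR p); assert (h2p := pow_lt 2 (S p) ltac:(lra));
  assert (hz2 : 0 < z ^ 2) by (apply pow_lt; lra);
  assert (hsmall : K / z ^ 2 <= 1 / 2) by (apply div_le_intro; nra);
  assert (hx : 0 <= x <= 2) by (apply Rabs_le_between in hy; lra);
  assert (hq1 : Rabs (x ^ S p - 1) <= 2 ^ S p * (K / z ^ 2)) by
    (eapply Rle_trans; [apply pow_sub1_le; lra | apply Rmult_le_compat_l; lra]);
  assert (hq2 : Rabs (x ^ S (S p) - 1) <= 2 ^ S (S p) * (K / z ^ 2)) by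
    (eapply Rle_trans; [apply pow_sub1_le; lra | apply Rmult_le_compat_l; [apply pow_le; lra | lra]]);
  destruct (inv_cosine_le u ltac:(lra)) as [hi1 hi2].

(** Every term is [O(z^-7)] once [x - 1] and [u] are [O(z^-2)]: three small factors over [z], two
    over [z^3], or one over [z^5]. *)
Lemma excess_error (p : nat) (K z x u : R) : 1 <= K -> 2 * K <= z ->
  Rabs (x - 1) <= K / z ^ 2 -> Rabs u <= K / z ^ 2 ->
  - (((INR p + 4) * K ^ 3 * (2 * 2 ^ S (S p) + 5)) / z ^ 7) <=
    (INR p + 2) / z * (u ^ 2 * (x ^ S p / cosine u - 1))
        - INR p / z ^ 3 * (u * (x ^ S (S p) - 1))
        - (INR p + 4) / z ^ 3 * (u * (/ cosine u - 1))
        - 3 * (INR p + 4) / z ^ 5 * (x - 1).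
Proof.
intros hK hz hy hu. prep p K z x u hK hz hy hu.
assert (hqc : Rabs (x ^ S p / cosine u - 1) <= (2 ^ S (S p) + 1) * (K / z ^ 2)).
{ replace (x ^ S p / cosine u - 1) with ((x ^ S p - 1) * / cosine u + (/ cosine u - 1)).
  2: { unfold Rdiv. ring. }
  eapply Rle_trans; [apply Rabs_triang|].
  assert (h := Rabs_mult_le _ (/ cosine u) _ 2 hq1 ltac:(rewrite Rabs_pos_eq; lra)).
  rewrite <- (tech_pow_Rmult 2 (S p)). lra. }
assert (hu2 : Rabs (u ^ 2) <= (K / z ^ 2) * (K / z ^ 2)).
{ replace (u ^ 2) with (u * u) by ring. apply Rabs_mult_le; assumption. }
assert (b1 := Rabs_mult_le _ _ _ _ hu2 hqc).
assert (b2 := Rabs_mult_le _ _ _ _ hu hq2).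
assert (b3 := Rabs_mult_le _ _ _ _ hu (Rle_trans _ _ _ hi2 hu)).
assert (hd : forall k a n b, 0 <= k -> Rabs a <= b -> - (k / z ^ n * b) <= k / z ^ n * a <= k / z ^ n * b).
{ intros k a n b hk h. apply Rabs_le_between in h.
  assert (0 <= k / z ^ n) by (apply Rdiv_le_0_compat; [lra | apply pow_lt; lra]). nra. }
assert (c1 := hd (INR p + 2) _ 1%nat _ ltac:(lra) b1).
assert (c2 := hd (INR p) _ 3%nat _ ltac:(lra) b2).
assert (c3 := hd (INR p + 4) _ 3%nat _ ltac:(lra) b3).
assert (c4 := hd (3 * (INR p + 4)) _ 5%nat _ ltac:(lra) hy).
rewrite pow_1 in c1.
assert (hw : 0 < / z ^ 7) by (apply Rinv_0_lt_compat, pow_lt; lra).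
set (T := 2 ^ S (S p)) in *. assert (hT : 0 < T) by (apply pow_lt; lra).
assert (e1 : (INR p + 2) / z * (K / z ^ 2 * (K / z ^ 2) * ((T + 1) * (K / z ^ 2)))
  = (INR p + 2) * K ^ 3 * (T + 1) * / z ^ 7) by (field; lra).
assert (e2 : INR p / z ^ 3 * (K / z ^ 2 * (T * (K / z ^ 2))) = INR p * K ^ 2 * T * / z ^ 7) by (field; lra).
assert (e3 : (INR p + 4) / z ^ 3 * (K / z ^ 2 * (K / z ^ 2)) = (INR p + 4) * K ^ 2 * / z ^ 7) by (field; lra).
assert (e4 : 3 * (INR p + 4) / z ^ 5 * (K / z ^ 2) = (INR p + 4) * K * 3 * / z ^ 7) by (field; lra).
rewrite e1 in c1; rewrite e2 in c2; rewrite e3 in c3; rewrite e4 in c4.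
assert (hK2 : K <= K ^ 2) by nra. assert (hK3 : K ^ 2 <= K ^ 3) by nra.
assert (big : (INR p + 2) * K ^ 3 * (T + 1) + INR p * K ^ 2 * T + (INR p + 4) * K ^ 2 + (INR p + 4) * K * 3
  <= (INR p + 4) * K ^ 3 * (2 * T + 5)).
{ assert (INR p * K ^ 2 * T <= INR p * K ^ 3 * T) by (apply Rmult_le_compat_r; [lra|]; apply Rmult_le_compat_l; lra).
  assert ((INR p + 4) * K ^ 2 <= (INR p + 4) * K ^ 3) by (apply Rmult_le_compat_l; lra).
  assert ((INR p + 4) * K <= (INR p + 4) * K ^ 3) by (apply Rmult_le_compat_l; lra).
  assert (0 <= K ^ 3 * T) by nra. assert (0 <= INR p * K ^ 3) by nra. nra. }
assert (big2 := Rmult_le_compat_r _ _ _ (Rlt_le _ _ hw) big).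
unfold Rdiv in *. lra.
Qed.

(** Replacing the powers of [rho] by 1 costs [O(z^-6)]; then [u^2 / 2], the virial term [- u / z^2]
    and [z^-4 / 2] form the square of [u - z^-2]. *)
Lemma excess_coercive (p : nat) (K : R) (r u : R -> R) (z : R) : 1 <= K -> 2 * K <= z ->
  Rabs (z * r z - 1) <= K / z ^ 2 -> Rabs (u z) <= K / z ^ 2 ->
  (z * r z - 1) ^ 2 / (INR p + 2) + (u z - / z ^ 2) ^ 2 / 2 <=
    excess p r u z + (K ^ 3 * (3 * 2 ^ S p + INR p + 4)) / z ^ 6.
Proof.
intros hK hz hy hu. unfold excess, lyap.
assert (hg := unduloid_gap p (z * r z) (u z)). revert hy hu hg.
generalize (z * r z) (u z). clear r u. intros x u hy hu hg. prep p K z x u hK hz hy hu.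
assert (h1 := hump_ge p x ltac:(lra)).
assert (h2 : (x - 1) ^ 2 / (INR p + 2) <=
  (1 - (INR p + 2) * x ^ S p + (INR p + 1) * x ^ S (S p)) / (INR p + 2)).
{ apply Rmult_le_compat_r; [apply Rlt_le, Rinv_0_lt_compat; lra | exact h1]. }
assert (hu' := hu). apply Rabs_le_between in hu'.
destruct (cosine_props u ltac:(lra)) as [hc [_ hc2]].
assert (hQ := pow_le_pow2 x (S p) ltac:(lra)).
assert (h3 : x ^ S p * (u ^ 2 / 2) <= x ^ S p * (1 - cosine u)) by (apply Rmult_le_compat_l; lra).
assert (hu2 : Rabs (u ^ 2) <= (K / z ^ 2) * (K / z ^ 2)).
{ replace (u ^ 2) with (u * u) by ring. apply Rabs_mult_le; assumption. }
assert (b1 := Rabs_mult_le _ _ _ _ hq1 hu2).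
assert (b2 := Rabs_mult_le _ _ _ _ hu hq2).
assert (hw : 0 < / z ^ 6) by (apply Rinv_0_lt_compat, pow_lt; lra).
assert (hw4 : 0 < / z ^ 4) by (apply Rinv_0_lt_compat, pow_lt; lra).
assert (hw2 : 0 < / z ^ 2) by (apply Rinv_0_lt_compat, pow_lt; lra).
apply Rabs_le_between in b1. apply Rabs_le_between in b2. apply Rabs_le_between in hy.
rewrite <- (tech_pow_Rmult 2 (S p)) in b2.
assert (c2 := Rmult_le_compat_r _ _ _ (Rlt_le _ _ hw2) (proj2 b2)).
assert (c3 := Rmult_le_compat_r _ _ _ (Rlt_le _ _ hw4) (proj1 hy)).
assert (c3' := Rmult_le_compat_l (INR p + 4) _ _ ltac:(lra) c3).
set (T := 2 ^ S p) in *.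
assert (e1 : T * (K / z ^ 2) * (K / z ^ 2 * (K / z ^ 2)) = T * K ^ 3 * / z ^ 6) by (field; lra).
assert (e2 : K / z ^ 2 * (2 * T * (K / z ^ 2)) * / z ^ 2 = 2 * T * K ^ 2 * / z ^ 6) by (field; lra).
assert (e3 : (INR p + 4) * (- (K / z ^ 2) * / z ^ 4) = - ((INR p + 4) * K * / z ^ 6)) by (field; lra).
rewrite e1 in b1; rewrite e2 in c2; rewrite e3 in c3'.
assert (hK2 : K <= K ^ 2) by nra. assert (hK3 : K ^ 2 <= K ^ 3) by nra.
assert (big : T * K ^ 3 + 2 * T * K ^ 2 + (INR p + 4) * K <= K ^ 3 * (3 * T + INR p + 4)) by nra.
assert (big2 := Rmult_le_compat_r _ _ _ (Rlt_le _ _ hw) big).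
assert (hT3 : 0 <= T * K ^ 3 * / z ^ 6).
{ apply Rmult_le_pos; [apply Rmult_le_pos; [lra | apply pow_le; lra] | lra]. }
assert (e5 : (u - / z ^ 2) ^ 2 / 2 = u ^ 2 / 2 - u / z ^ 2 + / z ^ 4 / 2) by (field; lra).
assert (e6 : x ^ S (S p) * u / z ^ 2 = u / z ^ 2 + u * (x ^ S (S p) - 1) * / z ^ 2) by (field; lra).
rewrite e5. unfold Rdiv in *. rewrite e6. lra.
Qed.
End NearCylinder.

(** The coarse bound enters as a hypothesis and makes the error in the derivative of [excess]
    [O(z^-7)]; integrated, this is [O(a^-6)], the square of the precision [a^-3]. *)
Lemma refined_decay (p : nat) (C : R) : 0 <= C -> exists K Z, 1 <= Z /\ 0 <= K /\
  forall (r u : R -> R) (a b : R), Z <= a <= b ->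
  (forall z, a <= z <= b -> profile p r u z /\ 0 < flux p r u z /\
     (z * r z - 1) ^ 2 / (INR p + 2) + (z * r z) ^ S p * u z ^ 2 / 4 <= C / z ^ 4) ->
  (a * r a - 1) ^ 2 / (INR p + 2) + (u a - / a ^ 2) ^ 2 / 2 <= excess p r u b + K / a ^ 6.
Proof.
intros hC. destruct (coarse_small p C hC) as [K [hK hsm]]. assert (hp := pos_INR p).
set (C1 := (INR p + 4) * K ^ 3 * (2 * 2 ^ S (S p) + 5)).
set (C2 := K ^ 3 * (3 * 2 ^ S p + INR p + 4)).
assert (hK3 : 0 < K ^ 3) by (apply pow_lt; lra).
assert (hC1 : 0 <= C1).
{ assert (h := pow_lt 2 (S (S p)) ltac:(lra)). apply Rmult_le_pos; [nra | lra]. }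
assert (hC2 : 0 <= C2).
{ assert (h := pow_lt 2 (S p) ltac:(lra)). apply Rmult_le_pos; lra. }
exists (C1 / 6 + C2), (2 * K). split; [lra|]. split; [lra|].
intros r u a b ha hs.
assert (small : forall z, a <= z <= b -> Rabs (z * r z - 1) <= K / z ^ 2 /\ Rabs (u z) <= K / z ^ 2).
{ intros z hz. destruct (hs z hz) as [h1 [h2 h3]].
  apply hsm; [lra | exact (rho_le2 p r u z ltac:(lra) h1 h2) | exact h3]. }
assert (h : excess p r u a - C1 / 6 * / a ^ 6 <= excess p r u b - C1 / 6 * / b ^ 6).
{ apply (nondecr_of_derive (fun z => excess p r u z - C1 / 6 * / z ^ 6) (fun z =>
    (INR p + 2) / z * (u z - / z ^ 2) ^ 2
     + ((INR p + 2) / z * (u z ^ 2 * ((z * r z) ^ S p / cosine (u z) - 1))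
        - INR p / z ^ 3 * (u z * ((z * r z) ^ S (S p) - 1))
        - (INR p + 4) / z ^ 3 * (u z * (/ cosine (u z) - 1))
        - 3 * (INR p + 4) / z ^ 5 * (z * r z - 1)) + C1 / z ^ 7)); [lra | |].
  - intros z hz. destruct (hs z hz) as [hpr _].
    assert (d := is_derive_excess p r u z ltac:(lra) hpr).
    revert d. generalize (excess p r u). intros f d. auto_derive.
    + assert (0 < z ^ 6) by (apply pow_lt; lra). simpl in *. derive_side; lra.
    + derive_val d. destruct (cosine_props (u z)) as [h1 _]; [apply hpr|]. field; lra.
  - intros z hz. destruct (small z hz) as [h1 h2].
    assert (h3 := excess_error p K z (z * r z) (u z) hK ltac:(lra) h1 h2).
    assert (h4 : 0 <= (INR p + 2) / z * (u z - / z ^ 2) ^ 2).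
    { apply Rmult_le_pos; [apply Rdiv_le_0_compat; lra | apply pow2_ge_0]. }
    fold C1 in h3. lra. }
destruct (small a ltac:(lra)) as [h1 h2].
assert (h3 := excess_coercive p K r u a hK ltac:(lra) h1 h2). fold C2 in h3.
assert (ha6 : 0 < / a ^ 6) by (apply Rinv_0_lt_compat, pow_lt; lra).
assert (hb6 : 0 < / b ^ 6) by (apply Rinv_0_lt_compat, pow_lt; lra).
assert (hb0 := Rmult_le_pos _ _ hC1 (Rlt_le _ _ hb6)).
unfold Rdiv in *. lra.
Qed.

(** * Recurrence to the cylinder *)

(* The dissipation of [lyap] controls [u], the second term adds control of
   [rho - 1], both with weight [rho^m]; the last one prevents [rho] from being
   small most of the time. *)
Definition psi (p : nat) (B : R) (r u : R -> R) (z : R) : R :=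
  4 * B * lyap p r u z - B * ((z * r z - 1) * (z * r z) ^ S (S p) * u z / z ^ 2)
  + z * r z * u z / z ^ 2.

(** Differentiating [u] in the two correction terms produces
    [- B (p+1) x^(p+1) (x - 1) (x - c) / z], close to a square, and [(p+1) (x - c) / z]. The terms
    of order [1 / z] and [z^-3] are kept apart. *)
Lemma is_derive_psi (p : nat) (B : R) (r u : R -> R) (z : R) : 0 < z -> profile p r u z ->
  let x := z * r z in let c := cosine (u z) in let Q := x ^ S p in
  is_derive (psi p B r u) z
    ((- 4 * B * (INR p + 2) * (u z ^ 2 / c * Q)
      + B * (x + (INR p + 2) * (x - 1)) * (u z ^ 2 / c * Q)
      - B * (INR p + 1) * Q * ((x - 1) * (x - c))
      - u z ^ 2 / c - (INR p + 1) * c + (INR p + 1) * x) / z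
     + (4 * B * INR p * x ^ S (S p) - B * (x * x ^ S (S p))
        - B * (INR p + 2) * (x - 1) * x ^ S (S p)
        + 2 * B * (x - 1) * x ^ S (S p) - x) * u z / z ^ 3).
Proof.
intros hz hpr x c Q. assert (dl := is_derive_lyap p r u z hz hpr).
assert (dx := is_derive_rho p r u z hpr).
destruct hpr as [hr [hu [dr du]]]. destruct (cosine_props _ hu) as [hc _].
assert (hp := pos_INR p).
assert (key : forall L X Y : R -> R, forall l xx y v, is_derive L z l -> is_derive X z xx ->
  is_derive Y z y -> is_derive u z v ->
  is_derive (fun w => 4 * B * L w - B * ((X w - 1) * Y w * u w / w ^ 2) + X w * u w / w ^ 2) z
    (4 * B * l - B * ((xx * Y z * u z + (X z - 1) * y * u z + (X z - 1) * Y z * v) / z ^ 2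
      - 2 * (X z - 1) * Y z * u z / z ^ 3)
      + (xx * u z + X z * v) / z ^ 2 - 2 * X z * u z / z ^ 3)).
{ intros L X Y l xx y v dL dX dY dv. auto_derive.
  - assert (0 < z ^ 2) by (apply pow_lt; lra). simpl in *. derive_side; lra.
  - derive_val dL. derive_val dX. derive_val dY. derive_val dv. field. lra. }
eapply is_derive_ext_val; [|exact (key _ _ _ _ _ _ _ dl dx (is_derive_pow_S _ (S p) z _ dx) du)].
unfold x, c, Q. cbv beta. rewrite S_INR, <- !(tech_pow_Rmult (z * r z)).
generalize ((z * r z) ^ p). intros P. field. lra.
Qed.

(** The coefficient [4 B] of [lyap] pays for the [u^2] terms of the second correction and for
    [(x-1)(x-c) >= (x-1)^2 - u^2]. The constant [-1] comes from [u^2 / c + c = 1 / c >= 1]; it keeps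
    the bound negative for small [x], where the weight [x^(p+1)] is useless. *)
Lemma psi_main_le (p : nat) (B x u : R) : 0 < B -> 0 < x <= 2 -> -1 < u < 1 ->
  - 4 * B * (INR p + 2) * (u ^ 2 / cosine u * x ^ S p)
      + B * (x + (INR p + 2) * (x - 1)) * (u ^ 2 / cosine u * x ^ S p)
      - B * (INR p + 1) * x ^ S p * ((x - 1) * (x - cosine u))
      - u ^ 2 / cosine u - (INR p + 1) * cosine u + (INR p + 1) * x
  <= - (B * (INR p + 1) * x ^ S p * (u ^ 2 + (x - 1) ^ 2)) - 1 + (INR p + 1) * x.
Proof.
intros hB hx hu. destruct (cosine_props _ hu) as [hc [hcu hc2]].
assert (hp := pos_INR p). assert (hQ := pow_lt x (S p) (proj1 hx)).
revert hQ hc hcu hc2. generalize (x ^ S p) (cosine u). intros Q c hQ hc hcu hc2.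
assert (hu2 := pow2_ge_0 u).
assert (h1 : u ^ 2 <= u ^ 2 / c) by (apply le_div_intro; nra).
assert (h2 : 1 <= u ^ 2 / c + c).
{ replace (u ^ 2 / c + c) with (1 / c).
  - apply le_div_intro; lra.
  - replace (u ^ 2) with (1 - c ^ 2) by lra. field; lra. }
revert h1 h2. generalize (u ^ 2 / c). intros s h1 h2.
assert (h3 : (x - 1) ^ 2 - u ^ 2 <= (x - 1) * (x - c)) by nra.
assert (hBQ : 0 < B * Q) by nra.
assert (h4 : B * Q * (INR p + 1) * ((x - 1) ^ 2 - u ^ 2) <= B * Q * (INR p + 1) * ((x - 1) * (x - c))).
{ apply Rmult_le_compat_l; [nra | exact h3]. }
assert (h5 : B * Q * s * (x + (INR p + 2) * (x - 1)) <= B * Q * s * (INR p + 4)).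
{ apply Rmult_le_compat_l; [nra | nra]. }
assert (h6 : B * Q * (2 * INR p + 3) * u ^ 2 <= B * Q * (2 * INR p + 3) * s).
{ apply Rmult_le_compat_l; nra. }
assert (h7 : 0 <= INR p * c) by nra.
assert (h8 : 0 <= B * Q * u ^ 2) by nra.
assert (h9 : 0 <= B * Q * u ^ 2 * INR p) by nra.
assert (h10 : 0 <= B * Q * s * INR p) by (apply Rmult_le_pos; nra).
nra.
Qed.

Lemma psi_rem_le (p : nat) (B x u : R) : 0 < B -> 0 < x <= 2 -> -1 < u < 1 ->
  (4 * B * INR p * x ^ S (S p) - B * (x * x ^ S (S p))
        - B * (INR p + 2) * (x - 1) * x ^ S (S p)
        + 2 * B * (x - 1) * x ^ S (S p) - x) * u <= B * (5 * INR p + 6) * 2 ^ S (S p) + 2.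
Proof.
intros hB hx hu. assert (hp := pos_INR p).
assert (hY := pow_le_pow2 x (S (S p)) ltac:(lra)).
set (Y := x ^ S (S p)) in *. set (T := 2 ^ S (S p)) in *.
replace ((4 * B * INR p * Y - B * (x * Y) - B * (INR p + 2) * (x - 1) * Y + 2 * B * (x - 1) * Y - x) * u)
  with (B * Y * ((4 * INR p - x - INR p * (x - 1)) * u) + x * (- u)) by ring.
assert (h1 : (4 * INR p - x - INR p * (x - 1)) * u <= 5 * INR p + 6).
{ assert (hk : - (5 * INR p + 6) <= 4 * INR p - x - INR p * (x - 1) <= 5 * INR p + 6) by nra.
  revert hk. generalize (4 * INR p - x - INR p * (x - 1)) (5 * INR p + 6). intros; nra. }
assert (h2 : B * Y * ((4 * INR p - x - INR p * (x - 1)) * u) <= B * Y * (5 * INR p + 6)).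
{ apply Rmult_le_compat_l; nra. }
assert (h3 : B * (5 * INR p + 6) * Y <= B * (5 * INR p + 6) * T) by (apply Rmult_le_compat_l; nra).
nra.
Qed.

Lemma psi_lower (p : nat) (B : R) (r u : R -> R) (z : R) : 0 < B -> 1 <= z ->
  0 < z * r z <= 2 -> -1 < u z < 1 ->
  - (9 * B * 2 ^ S (S p) + 2) <= psi p B r u z.
Proof.
intros hB hz hx hu. unfold psi, lyap, unduloid. assert (hp := pos_INR p).
revert hx hu. generalize (z * r z) (u z). clear r u. intros x u hx hu.
destruct (cosine_props _ hu) as [hc _].
assert (hQ := pow_le_pow2 x (S p) ltac:(lra)).
assert (hY := pow_le_pow2 x (S (S p)) ltac:(lra)).
set (Y := x ^ S (S p)) in *. set (T := 2 ^ S (S p)) in *.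
assert (hk : 0 < (INR p + 1) / (INR p + 2) <= 1).
{ split; [apply Rdiv_lt_0_compat; lra | apply div_le_intro; lra]. }
assert (h1 : 0 <= x ^ S p * cosine u) by nra.
assert (h2 : (INR p + 1) / (INR p + 2) * Y <= T).
{ apply Rle_trans with (1 * Y); [apply Rmult_le_compat_r; lra | lra]. }
assert (hv : - 1 <= u / z ^ 2 <= 1).
{ split; [apply le_div_intro | apply div_le_intro]; nra. }
replace (Y * u / z ^ 2) with (Y * (u / z ^ 2)) by (field; lra).
replace ((x - 1) * Y * u / z ^ 2) with (Y * ((x - 1) * (u / z ^ 2))) by (field; lra).
replace (x * u / z ^ 2) with (x * (u / z ^ 2)) by (field; lra).
revert hv h2. generalize (u / z ^ 2) ((INR p + 1) / (INR p + 2) * Y). intros v k hv h2.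
assert (h3 : - T <= Y * v) by nra.
assert (h4 : (x - 1) * v <= 1) by nra.
assert (h5 : Y * ((x - 1) * v) <= T) by nra.
assert (h6 : B * (Y * ((x - 1) * v)) <= B * T) by (apply Rmult_le_compat_l; lra).
assert (h7 : B * (- 2 * T) <= B * (x ^ S p * cosine u - k + Y * v)) by (apply Rmult_le_compat_l; lra).
nra.
Qed.

(** A solution staying away from the cylinder would make [psi] decrease at rate at least
    [1 / (4 z)], hence fall below any bound like [- ln z / 4], against [psi_lower]. *)
Lemma recurrence (p : nat) (r u : R -> R) :
  (forall z, 0 < z -> profile p r u z) ->
  forall eta t, 0 < eta -> exists z, t <= z /\ 1 <= z /\ (z * r z - 1) ^ 2 + u z ^ 2 < eta.
Proof.
intros hs eta t heta. apply Classical_Prop.NNPP. intros hno.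
assert (hp := pos_INR p). assert (hF := flux_pos p r u hs).
assert (far : forall z, t <= z -> 1 <= z -> eta <= u z ^ 2 + (z * r z - 1) ^ 2).
{ intros z h1 h2. apply Rnot_lt_le. intros h3. apply hno. exists z. repeat split; lra. }
(* The threshold is [(p+1) x = 1/2]: below it [-1 + (p+1) x <= -1/2], above it the weight [x^(p+1)]
   is at least [q0]. *)
set (q0 := (1 / (2 * (INR p + 1))) ^ S p).
assert (hq0 : 0 < q0) by (apply pow_lt, Rdiv_lt_0_compat; lra).
(* Above the threshold the weighted square is then at least [2 (p+1)], which beats [(p+1) x] since
   [x <= 2]. *)
set (B := 2 / (q0 * eta)). assert (hB : 0 < B) by (apply Rdiv_lt_0_compat; nra).
assert (hBe : B * (q0 * eta) = 2) by (unfold B; field; lra).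
set (C := B * (5 * INR p + 6) * 2 ^ S (S p) + 2).
assert (hC : 2 <= C).
{ assert (h := pow_lt 2 (S (S p)) ltac:(lra)). unfold C.
  assert (0 <= B * (5 * INR p + 6) * 2 ^ S (S p)); [|lra].
  apply Rmult_le_pos; [nra | lra]. }
set (t0 := Rmax (Rmax t 1) (4 * C)).
assert (ht0 : t <= t0 /\ 1 <= t0 /\ 4 * C <= t0).
{ unfold t0. assert (h1 := Rmax_l (Rmax t 1) (4 * C)). assert (h2 := Rmax_r (Rmax t 1) (4 * C)).
  assert (h3 := Rmax_l t 1). assert (h4 := Rmax_r t 1). lra. }
set (D := 9 * B * 2 ^ S (S p) + 2).
(* Between [t0] and [b = t0 exp s] the logarithm grows by [s], so [psi] would drop by [s / 4], one
   more than its lower bound allows. *)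
set (s := 4 * (psi p B r u t0 + D) + 4).
assert (lower : forall z, t0 <= z -> - D <= psi p B r u z).
{ intros z hz. apply psi_lower; [exact hB | lra | |].
  - apply (rho_le2 p r u z); [lra | apply hs; lra | apply hF; lra].
  - apply (hs z ltac:(lra)). }
assert (hs0 : 4 <= s) by (assert (h := lower t0 ltac:(lra)); unfold s; lra).
set (b := t0 * exp s).
assert (hb : t0 <= b) by (assert (h := exp_ineq1 s ltac:(lra)); unfold b; nra).
assert (hm : - psi p B r u t0 - ln t0 / 4 <= - psi p B r u b - ln b / 4).
{ eapply (nondecr_of_derive (fun z => - psi p B r u z - ln z / 4)
    (fun z => - Derive (psi p B r u) z - / z / 4)); [exact hb | |].
  - intros z hz. assert (d := is_derive_psi p B r u z ltac:(lra) (hs z ltac:(lra))).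
    cbv zeta in d. apply ex_intro in d. apply Derive_correct in d. revert d.
    generalize (psi p B r u). intros f d. auto_derive.
    + derive_side; lra.
    + derive_val d. field; lra.
  - intros z hz. assert (hz0 : 0 < z) by lra. assert (hpr := hs z hz0).
    assert (hx := rho_le2 p r u z hz0 hpr (hF z hz0)).
    rewrite (is_derive_unique _ _ _ (is_derive_psi p B r u z hz0 hpr)). cbv zeta.
    assert (hu : -1 < u z < 1) by apply hpr.
    assert (m1 := psi_main_le p B _ _ hB hx hu). assert (m2 := psi_rem_le p B _ _ hB hx hu).
    specialize (far z ltac:(lra) ltac:(lra)). fold C in m2.
    revert m1 m2 hx far hu. generalize (z * r z) (u z). intros x v m1 m2 hx far hu.
    assert (half : - (B * (INR p + 1) * x ^ S p * (v ^ 2 + (x - 1) ^ 2)) - 1 + (INR p + 1) * x <= - (1 / 2)).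
    { assert (hQ := pow_le x (S p) ltac:(lra)).
      destruct (Rle_lt_dec ((INR p + 1) * x) (1 / 2)) as [hl|hl].
      - assert (0 <= B * (INR p + 1) * x ^ S p * (v ^ 2 + (x - 1) ^ 2)); [|lra].
        apply Rmult_le_pos; [|lra]. apply Rmult_le_pos; nra.
      - assert (h1 : 1 / (2 * (INR p + 1)) <= x) by (apply div_le_intro; lra).
        assert (h2 : q0 <= x ^ S p).
        { apply pow_incr. split; [|exact h1]. apply Rdiv_le_0_compat; lra. }
        assert (h3 : q0 * eta <= x ^ S p * (v ^ 2 + (x - 1) ^ 2)) by (apply Rmult_le_compat; lra).
        assert (h4 : B * (q0 * eta) <= B * (x ^ S p * (v ^ 2 + (x - 1) ^ 2))) by (apply Rmult_le_compat_l; lra).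
        nra. }
    assert (m3 := Rle_trans _ _ _ m1 half).
    assert (hz1 : 0 < / z) by (apply Rinv_0_lt_compat; lra).
    assert (hz3 : 0 < / z ^ 3) by (apply Rinv_0_lt_compat, pow_lt; lra).
    assert (m4 := Rmult_le_compat_r _ _ _ (Rlt_le _ _ hz1) m3).
    assert (m5 := Rmult_le_compat_r _ _ _ (Rlt_le _ _ hz3) m2).
    assert (m6 : C * / z ^ 3 <= / z / 4).
    { replace (C * / z ^ 3) with (C / z ^ 2 * / z) by (field; lra).
      assert (C / z ^ 2 <= 1 / 4) by (apply div_le_intro; nra). nra. }
    unfold Rdiv in *. lra. }
assert (hln : ln b = ln t0 + s).
{ unfold b. rewrite ln_mult; [now rewrite ln_exp | lra | apply exp_pos]. }
assert (hl := lower b hb). rewrite hln in hm. unfold s in hm. lra.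
Qed.

(** * Asymptotics of global and of shot solutions *)

Lemma coarse_decay (p : nat) : exists C, 0 <= C /\
  forall (r u : R -> R) (a b d : R), 0 < a <= b ->
  (forall z, a <= z <= b -> profile p r u z /\ 0 < flux p r u z) ->
  1 / (INR p + 2) - lyap p r u b <= d ->
  (a * r a - 1) ^ 2 / (INR p + 2) + (a * r a) ^ S p * u a ^ 2 / 4 <= d + C / a ^ 4.
Proof.
assert (hp := pos_INR p). assert (h2p := pow_lt 2 (S p) ltac:(lra)).
exists (INR p ^ 2 * 2 ^ S p + 4 * 2 ^ S p). split; [nra|].
intros r u a b d ha hs hd. assert (h := lyap_decay p r u a b ha hs).
destruct (hs a ltac:(lra)) as [hpr hF].
assert (hx := rho_le2 p r u a ltac:(lra) hpr hF).
assert (hc := lyap_coercive p r u a (d + INR p ^ 2 * 2 ^ S p / a ^ 4) ltac:(lra) hx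
  ltac:(apply hpr) ltac:(lra)).
replace (d + (INR p ^ 2 * 2 ^ S p + 4 * 2 ^ S p) / a ^ 4)
  with (d + INR p ^ 2 * 2 ^ S p / a ^ 4 + 4 * 2 ^ S p / a ^ 4) by (field; lra).
exact hc.
Qed.

(** The centre [u = z^-2] is the slope of the leading profile: [r = 1 / z] has [tan theta = z^-2].
    The precision [z^-3] is what [coupling_small] consumes. *)
Definition near (K : R) (r u : R -> R) (z : R) : Prop :=
  Rabs (z * r z - 1) <= K / z ^ 3 /\ Rabs (u z - / z ^ 2) <= K / z ^ 3.

Lemma near_of_sq (p : nat) (C : R) (r u : R -> R) (z : R) : 0 <= C -> 0 < z ->
  (z * r z - 1) ^ 2 / (INR p + 2) + (u z - / z ^ 2) ^ 2 / 2 <= C / z ^ 6 ->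
  near (1 + (INR p + 2) * C + 2 * C) r u z.
Proof.
intros hC hz h. assert (hp := pos_INR p). set (K := 1 + (INR p + 2) * C + 2 * C).
assert (hK0 : 0 <= (INR p + 2) * C) by nra. assert (hK : 1 <= K) by (unfold K; lra).
assert (hz3 : 0 < / z ^ 6) by (apply Rinv_0_lt_compat, pow_lt; lra).
assert (hKz : 0 <= K / z ^ 3) by (apply Rdiv_le_0_compat; [lra | apply pow_lt; lra]).
assert (e : (K / z ^ 3) ^ 2 = K ^ 2 * / z ^ 6) by (field; lra).
assert (h1 : 0 <= (z * r z - 1) ^ 2 / (INR p + 2)) by (apply Rdiv_le_0_compat; [apply pow2_ge_0 | lra]).
assert (h2 : 0 <= (u z - / z ^ 2) ^ 2 / 2) by (apply Rdiv_le_0_compat; [apply pow2_ge_0 | lra]).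
split; apply Rabs_le_of_sq; try exact hKz; rewrite e.
- replace ((z * r z - 1) ^ 2) with ((INR p + 2) * ((z * r z - 1) ^ 2 / (INR p + 2))) by (field; lra).
  apply Rle_trans with ((INR p + 2) * (C / z ^ 6)); [apply Rmult_le_compat_l; lra|].
  replace ((INR p + 2) * (C / z ^ 6)) with ((INR p + 2) * C * / z ^ 6) by (field; lra).
  apply Rmult_le_compat_r; [lra|]. unfold K in *. nra.
- apply Rle_trans with (2 * (C / z ^ 6)); [lra|].
  replace (2 * (C / z ^ 6)) with (2 * C * / z ^ 6) by (field; lra).
  apply Rmult_le_compat_r; [lra|]. unfold K in *. nra.
Qed.

Lemma accumulation (p : nat) (r u : R -> R) :
  (forall z, 0 < z -> profile p r u z) ->
  forall d t, 0 < d -> exists b, t <= b /\ 1 <= b /\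
    1 / (INR p + 2) - lyap p r u b <= d /\ excess p r u b <= d.
Proof.
intros hs d t hd. assert (hp := pos_INR p). assert (h2p := pow_lt 2 (S p) ltac:(lra)).
destruct (hump_le p) as [C [hC hhump]].
set (C0 := C + 2 ^ S p + 2 * 2 ^ S p + (INR p + 4)). assert (hC0 : 1 <= C0) by (unfold C0; lra).
set (e := Rmin 1 (d / (2 * C0))).
assert (he : 0 < e <= 1 /\ C0 * e <= d / 2).
{ assert (h0 : 0 < d / (2 * C0)) by (apply Rdiv_lt_0_compat; lra).
  assert (h1 := Rmin_l 1 (d / (2 * C0))). assert (h2 := Rmin_r 1 (d / (2 * C0))).
  fold e in h1, h2. repeat split.
  - apply Rmin_glb_lt; lra.
  - lra.
  - replace (d / 2) with (C0 * (d / (2 * C0))) by (field; lra). apply Rmult_le_compat_l; lra. }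
clearbody e.
(* Asking for a height above [1 / d] makes the term [b^-4 / 2] of [excess] at most [d / 2]; the
   terms that are small with [e] use the other half. *)
destruct (recurrence p r u hs (e ^ 2) (Rmax t (/ d)) ltac:(apply pow_lt; lra)) as [b [hb1 [hb2 hb]]].
assert (hb3 := Rmax_l t (/ d)). assert (hb4 := Rmax_r t (/ d)).
exists b. split; [lra|]. split; [lra|].
assert (hpr := hs b ltac:(lra)).
assert (hx := rho_le2 p r u b ltac:(lra) hpr (flux_pos p r u hs b ltac:(lra))).
assert (hu : -1 < u b < 1) by apply hpr. destruct (cosine_props _ hu) as [hc [_ hc2]].
assert (hg := unduloid_gap p (b * r b) (u b)).
assert (hi : / b <= d).
{ rewrite <- (Rinv_inv d). apply Rinv_le_contravar; [apply Rinv_0_lt_compat|]; lra. }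
unfold excess, lyap. revert hb hx hu hc hc2 hg. generalize (b * r b) (u b).
intros x v hb hx hu hc hc2 hg.
assert (sx := pow2_ge_0 (x - 1)). assert (sv := pow2_ge_0 v).
assert (hxe : Rabs (x - 1) <= e) by (apply Rabs_le_of_sq; lra).
assert (hve : Rabs v <= e) by (apply Rabs_le_of_sq; lra).
apply Rabs_le_between in hxe. apply Rabs_le_between in hve.
assert (hh := hhump x ltac:(lra)).
assert (hQ := pow_le_pow2 x (S p) ltac:(lra)).
assert (hY := pow_le_pow2 x (S (S p)) ltac:(lra)). rewrite <- (tech_pow_Rmult 2 (S p)) in hY.
assert (g1 : (1 - (INR p + 2) * x ^ S p + (INR p + 1) * x ^ S (S p)) / (INR p + 2) <= C * e).
{ apply div_le_intro; [lra|]. apply Rle_trans with (C * (x - 1) ^ 2); [exact hh|].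
  assert (h1 : (x - 1) ^ 2 <= e) by nra.
  assert (h2 : C * (x - 1) ^ 2 <= C * e) by (apply Rmult_le_compat_l; lra).
  assert (h3 : 0 <= C * e) by nra. nra. }
assert (g2 : x ^ S p * (1 - cosine v) <= 2 ^ S p * e) by (apply Rmult_le_compat; nra).
assert (hw : 0 < / b ^ 2 <= 1).
{ split; [apply Rinv_0_lt_compat, pow_lt; lra|]. rewrite <- Rinv_1. apply Rinv_le_contravar; nra. }
assert (hvw : - e <= v / b ^ 2) by (unfold Rdiv; nra).
assert (g3 : - (2 * 2 ^ S p * e) <= x ^ S (S p) * v / b ^ 2).
{ replace (x ^ S (S p) * v / b ^ 2) with (x ^ S (S p) * (v / b ^ 2)) by (field; lra).
  revert hvw hY. generalize (v / b ^ 2) (x ^ S (S p)). intros y Y hvw hY.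
  assert (Y * (- e) <= Y * y) by (apply Rmult_le_compat_l; lra).
  assert (Y * e <= 2 * 2 ^ S p * e) by (apply Rmult_le_compat_r; lra). lra. }
assert (hw4 : 0 < / b ^ 4 <= / b).
{ split; [apply Rinv_0_lt_compat, pow_lt; lra|]. apply Rinv_le_contravar; [lra|].
  assert (h := Rle_pow b 1 4 hb2 ltac:(lia)). lra. }
assert (hib : / b <= 1) by (rewrite <- Rinv_1; apply Rinv_le_contravar; lra).
assert (g4 : (INR p + 4) * (x - 1) / b ^ 4 <= (INR p + 4) * e).
{ unfold Rdiv. assert (h1 : (INR p + 4) * (x - 1) * / b ^ 4 <= (INR p + 4) * e * / b ^ 4).
  { apply Rmult_le_compat_r; [lra|]. apply Rmult_le_compat_l; lra. }
  assert (h2 : (INR p + 4) * e * / b ^ 4 <= (INR p + 4) * e * 1) by (apply Rmult_le_compat_l; [nra | lra]).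
  lra. }
assert (g5 : 0 <= (INR p + 4) * e) by nra.
unfold C0 in he. split; lra.
Qed.

(** Both decay lemmas are applied on [[z, b]] with [b] from [accumulation]: the terminal gap can be
    taken below half of any supposed violation, so it disappears. The coarse bound at all heights is
    the input of the refined one. *)
Lemma near_global (p : nat) : exists K Z, 0 <= K /\ 1 <= Z /\
  forall r u : R -> R, (forall z, 0 < z -> profile p r u z) -> forall z, Z <= z -> near K r u z.
Proof.
destruct (coarse_decay p) as [C [hC hcoarse]].
destruct (refined_decay p C hC) as [K [Z [hZ [hK href]]]].
assert (hp := pos_INR p).
exists (1 + (INR p + 2) * K + 2 * K), Z.
split; [nra|]. split; [lra|].
intros r u hs. assert (hF := flux_pos p r u hs).
assert (hcs : forall z, 0 < z ->
  (z * r z - 1) ^ 2 / (INR p + 2) + (z * r z) ^ S p * u z ^ 2 / 4 <= C / z ^ 4).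
{ intros z hz. apply Rnot_lt_le. intros hlt.
  set (d := (z * r z - 1) ^ 2 / (INR p + 2) + (z * r z) ^ S p * u z ^ 2 / 4 - C / z ^ 4).
  destruct (accumulation p r u hs (d / 2) z ltac:(unfold d; lra)) as [b [hb [_ [h _]]]].
  assert (h1 := hcoarse r u z b (d / 2) ltac:(lra)
    (fun y hy => conj (hs y ltac:(lra)) (hF y ltac:(lra))) h).
  unfold d in h1. lra. }
intros z hz. apply near_of_sq; [exact hK | lra|].
apply Rnot_lt_le. intros hlt.
set (d := (z * r z - 1) ^ 2 / (INR p + 2) + (u z - / z ^ 2) ^ 2 / 2 - K / z ^ 6).
destruct (accumulation p r u hs (d / 2) z ltac:(unfold d; lra)) as [b [hb [_ [_ h]]]].
assert (h1 := href r u z b ltac:(lra)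
    (fun y hy => conj (hs y ltac:(lra)) (conj (hF y ltac:(lra)) (hcs y ltac:(lra))))).
unfold d in *. lra.
Qed.

(** Divided by [r^(p+1)], the flux is [cos theta - 1 + 1/(p+2)], and [1 - cos theta <= u^2 = b^-4];
    the bound [p + 3] puts this below [1/(p+2)]. *)
Lemma flux_pos_terminal (p : nat) (r u : R -> R) (b : R) : INR p + 3 <= b ->
  b * r b = 1 -> u b = / b ^ 2 -> 0 < flux p r u b.
Proof.
intros hb hr hu. assert (hp := pos_INR p).
assert (hr0 : r b = / b) by (apply (Rmult_eq_reg_l b); [rewrite hr; field|]; lra).
assert (hw : 0 < / b ^ 4 < / (INR p + 2)).
{ split; [apply Rinv_0_lt_compat, pow_lt; lra|].
  assert (h := Rle_pow b 1 4 ltac:(lra) ltac:(lia)).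
  apply Rinv_lt_contravar; [|lra]. apply Rmult_lt_0_compat; [lra | apply pow_lt; lra]. }
assert (he : u b ^ 2 = / b ^ 4) by (rewrite hu; field; lra).
assert (hi : / (INR p + 2) < 1) by (rewrite <- Rinv_1; apply Rinv_lt_contravar; lra).
destruct (cosine_props (u b)) as [hc [_ hc2]]; [nra|].
rewrite flux_split, hr. apply Rmult_lt_0_compat.
- apply pow_lt. rewrite hr0. apply Rinv_0_lt_compat; lra.
- replace ((INR p + 1) / (INR p + 2) * 1) with (1 - / (INR p + 2)) by (field; lra). lra.
Qed.

(** The same two rounds as for global solutions, with the explicit terminal data in place of
    recurrence. That [K] and [Z] do not depend on [b] is what allows [b] to tend to infinity. *)
Lemma near_terminal (p : nat) : exists K Z, 0 <= K /\ INR p + 3 <= Z /\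
  forall (r u : R -> R) (b : R), Z <= b -> b * r b = 1 -> u b = / b ^ 2 ->
  (forall z, Z <= z <= b -> profile p r u z) -> forall z, Z <= z <= b -> near K r u z.
Proof.
destruct (coarse_decay p) as [C [hC hcoarse]].
destruct (refined_decay p C hC) as [K [Z [hZ [hK href]]]].
assert (hp := pos_INR p).
exists (1 + (INR p + 2) * (K + 1) + 2 * (K + 1)), (Rmax Z (INR p + 3)).
assert (hm1 := Rmax_l Z (INR p + 3)). assert (hm2 := Rmax_r Z (INR p + 3)).
split; [nra|]. split; [exact hm2|].
revert hm1 hm2. generalize (Rmax Z (INR p + 3)). intros Z' hm1 hm2.
intros r u b hb hrb hub hs.
assert (hFb := flux_pos_terminal p r u b ltac:(lra) hrb hub).
assert (hF : forall z, Z' <= z <= b -> 0 < flux p r u z).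
{ intros z hz. apply Rlt_le_trans with (1 := hFb).
  apply flux_decr; [lra|]. intros y hy. apply hs; lra. }
assert (hu : -1 < u b < 1) by (apply (hs b ltac:(lra))).
destruct (cosine_props _ hu) as [hc [hcu hc2]].
assert (hub2 : u b ^ 2 = / b ^ 4) by (rewrite hub; field; lra).
assert (hl : 1 / (INR p + 2) - lyap p r u b = 1 - cosine (u b) - / b ^ 4).
{ unfold lyap, unduloid. rewrite hrb, !pow1, hub. field. lra. }
assert (hcs : forall z, Z' <= z <= b ->
  (z * r z - 1) ^ 2 / (INR p + 2) + (z * r z) ^ S p * u z ^ 2 / 4 <= C / z ^ 4).
{ intros z hz. rewrite <- (Rplus_0_l (C / z ^ 4)).
  apply (hcoarse r u z b 0); [lra | | rewrite hl; lra].
  intros y hy. split; [apply hs | apply hF]; lra. }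
intros z hz. apply near_of_sq; [lra | lra|].
assert (h1 := href r u z b ltac:(lra)
    (fun y hy => conj (hs y ltac:(lra)) (conj (hF y ltac:(lra)) (hcs y ltac:(lra))))).
assert (he : excess p r u b <= / z ^ 6).
{ unfold excess. rewrite hl, hrb.
  replace ((INR p + 4) * (1 - 1) / b ^ 4) with 0 by (field; lra).
  (* At the terminal point [excess] equals [1 - cos theta - u^2 / 2 = (1 - cos theta)^2 / 2], so the
     choice [u = b^-2] leaves only [O(b^-8)]. *)
  apply Rle_trans with ((u b ^ 2) ^ 2); [rewrite <- hub2; nra|].
  rewrite hub2. apply Rle_trans with (/ b ^ 6).
  - replace ((/ b ^ 4) ^ 2) with (/ b ^ 8) by (field; lra).
    apply Rinv_le_contravar; [apply pow_lt; lra | apply Rle_pow; [lra | lia]].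
  - apply Rinv_le_contravar; [apply pow_lt; lra | apply pow_incr; lra]. }
unfold Rdiv in *. lra.
Qed.

(** * Comparison of two solutions near the cylinder *)

(** From [c1^2 - c2^2 = u2^2 - u1^2]. This and the next two identities are exact difference
    quotients, serving the energy identity as well as the Lipschitz bounds. *)
Lemma cosine_sub (u1 u2 : R) : -1 < u1 < 1 -> -1 < u2 < 1 ->
  cosine u1 - cosine u2 = - ((u1 + u2) / (cosine u1 + cosine u2) * (u1 - u2)).
Proof.
intros h1 h2. destruct (cosine_props _ h1) as [p1 [q1 _]]. destruct (cosine_props _ h2) as [p2 [q2 _]].
apply (Rmult_eq_reg_r (cosine u1 + cosine u2)); [|lra]. field_simplify; [|lra].
rewrite q1, q2. ring.
Qed.

Lemma tangent_sub (u1 u2 : R) : -1 < u1 < 1 -> -1 < u2 < 1 ->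
  u1 / cosine u1 - u2 / cosine u2 =
  (/ cosine u1 + u2 * (u1 + u2) / ((cosine u1 + cosine u2) * cosine u1 * cosine u2)) * (u1 - u2).
Proof.
intros h1 h2. destruct (cosine_props _ h1) as [p1 _]. destruct (cosine_props _ h2) as [p2 _].
replace (u1 / cosine u1 - u2 / cosine u2) with
  ((u1 - u2) / cosine u1 - u2 / (cosine u1 * cosine u2) * (cosine u1 - cosine u2)) by (field; lra).
rewrite cosine_sub by assumption. field. lra.
Qed.

Lemma curvature_sub (u1 u2 r1 r2 : R) : -1 < u1 < 1 -> -1 < u2 < 1 -> 0 < r1 -> 0 < r2 ->
  cosine u1 / r1 - cosine u2 / r2 =
  - ((u1 + u2) / ((cosine u1 + cosine u2) * r1) * (u1 - u2)) - cosine u2 / (r1 * r2) * (r1 - r2).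
Proof.
intros h1 h2 h3 h4. destruct (cosine_props _ h1) as [p1 _]. destruct (cosine_props _ h2) as [p2 _].
replace (cosine u1 / r1 - cosine u2 / r2) with
  ((cosine u1 - cosine u2) / r1 - cosine u2 / (r1 * r2) * (r1 - r2)) by (field; lra).
rewrite cosine_sub by assumption. field. lra.
Qed.

(** The weight [p + 1] makes this the quadratic invariant of the linearised flow [y' = - v],
    [v' = (p+1) y] at the cylinder. *)
Definition energy (p : nat) (r1 u1 r2 u2 : R -> R) (z : R) : R :=
  (u1 z - u2 z) ^ 2 + (INR p + 1) * (z * r1 z - z * r2 z) ^ 2.

Lemma energy_ge (p : nat) (r1 u1 r2 u2 : R -> R) (z : R) : 1 <= z ->
  (r1 z - r2 z) ^ 2 + (u1 z - u2 z) ^ 2 <= z * energy p r1 u1 r2 u2 z.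
Proof.
intros hz. unfold energy. assert (hp := pos_INR p).
replace (z * r1 z - z * r2 z) with (z * (r1 z - r2 z)) by ring.
rewrite Rpow_mult_distr.
assert (h1 := pow2_ge_0 (r1 z - r2 z)). assert (h2 := pow2_ge_0 (u1 z - u2 z)).
assert (h3 : 1 <= z ^ 2) by nra.
assert (h4 : (r1 z - r2 z) ^ 2 <= (INR p + 1) * (z ^ 2 * (r1 z - r2 z) ^ 2)).
{ apply Rle_trans with (1 * (1 * (r1 z - r2 z) ^ 2)); [lra|].
  apply Rmult_le_compat; [lra | lra | lra |]. apply Rmult_le_compat_r; lra. }
nra.
Qed.

(** The first [energy] comes from the weight [z], the [dx^2] term from the drift of [rho]. The
    [du^2] coefficient has the sign of [u1 + u2], and the bracket before [du * dx] vanishes at the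
    cylinder, so it is the only term to be estimated. *)
Lemma is_derive_energy (p : nat) (r1 u1 r2 u2 : R -> R) (z : R) : 0 < z ->
  profile p r1 u1 z -> profile p r2 u2 z ->
  let du := u1 z - u2 z in let dx := z * r1 z - z * r2 z in
  let s := cosine (u1 z) + cosine (u2 z) in
  is_derive (fun y => y * energy p r1 u1 r2 u2 y) z
    (energy p r1 u1 r2 u2 z + 2 * (INR p + 1) * dx ^ 2
     + 2 * (INR p + 1) * z ^ 2 * ((u1 z + u2 z) / (s * (z * r1 z))) * du ^ 2
     + 2 * (INR p + 1) * (z ^ 2 * (cosine (u2 z) / ((z * r1 z) * (z * r2 z))
        - (/ cosine (u1 z) + u2 z * (u1 z + u2 z) / (s * cosine (u1 z) * cosine (u2 z)))))
       * (du * dx)).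
Proof.
intros hz hpr1 hpr2 du dx s.
assert (dx1 := is_derive_rho p r1 u1 z hpr1). assert (dx2 := is_derive_rho p r2 u2 z hpr2).
destruct hpr1 as [hr1 [hu1 [_ du1]]]. destruct hpr2 as [hr2 [hu2 [_ du2]]].
destruct (cosine_props _ hu1) as [hc1 _]. destruct (cosine_props _ hu2) as [hc2 _].
assert (hp := pos_INR p).
assert (key : forall X1 X2 : R -> R, forall a b c d, is_derive X1 z a -> is_derive X2 z b ->
  is_derive u1 z c -> is_derive u2 z d ->
  is_derive (fun y => y * ((u1 y - u2 y) ^ 2 + (INR p + 1) * (X1 y - X2 y) ^ 2)) z
   ((u1 z - u2 z) ^ 2 + (INR p + 1) * (X1 z - X2 z) ^ 2
    + z * (2 * (u1 z - u2 z) * (c - d) + 2 * (INR p + 1) * (X1 z - X2 z) * (a - b)))).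
{ intros X1 X2 a b c d d1 d2 d3 d4. auto_derive; [derive_side|].
  derive_val d1. derive_val d2. derive_val d3. derive_val d4. ring. }
eapply is_derive_ext_val; [|exact (key _ _ _ _ _ _ dx1 dx2 du1 du2)].
cbv beta. unfold energy.
replace ((INR p + 1) * (z - cosine (u1 z) / r1 z) - (INR p + 1) * (z - cosine (u2 z) / r2 z))
  with (- (INR p + 1) * (cosine (u1 z) / r1 z - cosine (u2 z) / r2 z)) by ring.
replace (r1 z - z * (u1 z / cosine (u1 z)) - (r2 z - z * (u2 z / cosine (u2 z))))
  with (r1 z - r2 z - z * (u1 z / cosine (u1 z) - u2 z / cosine (u2 z))) by ring.
rewrite tangent_sub, curvature_sub by assumption.
unfold du, dx, s. field. repeat split; nra.
Qed.

Lemma near_bounds (K w x u : R) : 0 <= K -> 0 < w <= 1 / 8 -> K * w <= 1 / 8 ->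
  Rabs (x - 1) <= K * w ^ 3 -> Rabs (u - w ^ 2) <= K * w ^ 3 ->
  1 - 1 / 8 <= x <= 1 + 1 / 8 /\ 0 <= u <= 2 * w ^ 2 /\ u <= 1 / 8 /\
  1 - w ^ 3 <= cosine u <= 1 /\ 1 / 2 <= cosine u.
Proof.
intros hK hw hKw hx hu. apply Rabs_le_between in hx. apply Rabs_le_between in hu.
assert (h2 : 0 < w ^ 2 <= w / 8) by nra. assert (h3 : 0 < w ^ 3 <= w ^ 2 / 8) by nra.
assert (h4 : 0 <= K * w ^ 3 <= w ^ 2) by nra.
assert (hu2 : 0 <= u <= 2 * w ^ 2) by lra.
destruct (cosine_props u ltac:(lra)) as [hc [_ hc2]].
assert (hu4 : u ^ 2 <= w ^ 3).
{ apply Rle_trans with (4 * w ^ 4); [|nra].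
  replace (4 * w ^ 4) with ((2 * w ^ 2) ^ 2) by ring. apply pow_incr; lra. }
repeat split; lra.
Qed.

(** Here [w] is [1 / z]. The coupling is multiplied by [z^2] in the energy identity, so the order
    [w^3] is what leaves a factor tending to 0. *)
Lemma coupling_small (K w x1 x2 u1 u2 : R) : 0 <= K -> 0 < w <= 1 / 8 -> K * w <= 1 / 8 ->
  Rabs (x1 - 1) <= K * w ^ 3 -> Rabs (x2 - 1) <= K * w ^ 3 ->
  Rabs (u1 - w ^ 2) <= K * w ^ 3 -> Rabs (u2 - w ^ 2) <= K * w ^ 3 ->
  Rabs (cosine u2 / (x1 * x2)
    - (/ cosine u1 + u2 * (u1 + u2) / ((cosine u1 + cosine u2) * cosine u1 * cosine u2)))
  <= (40 + 8 * K) * w ^ 3.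
Proof.
intros hK hw hKw hx1 hx2 hu1 hu2.
destruct (near_bounds K w x1 u1 hK hw hKw hx1 hu1) as [bx1 [bu1 [_ [bc1 hf1]]]].
destruct (near_bounds K w x2 u2 hK hw hKw hx2 hu2) as [bx2 [bu2 [_ [bc2 hf2]]]].
apply Rabs_le_between in hx1. apply Rabs_le_between in hx2.
assert (h2 : 0 < w ^ 2 <= w / 8) by nra. assert (h3 : 0 < w ^ 3 <= w ^ 2 / 8) by nra.
assert (h4 : 0 <= K * w ^ 3) by nra.
revert bc1 bc2 hf1 hf2. generalize (cosine u1) (cosine u2). intros c1 c2 bc1 bc2 hf1 hf2.
assert (hX : 1 / 2 <= x1 * x2) by nra.
assert (hX2 : 1 - 3 * (K * w ^ 3) <= x1 * x2 <= 1 + 3 * (K * w ^ 3)) by nra.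
assert (g : 1 - 2 * w ^ 3 - 6 * (K * w ^ 3) <= c2 / (x1 * x2) <= 1 + 6 * (K * w ^ 3)).
{ revert hX hX2 h4. generalize (x1 * x2) (K * w ^ 3). intros X k hX hX2 h4.
  split; [apply le_div_intro; nra | apply div_le_intro; nra]. }
assert (hi : 1 <= / c1 <= 1 + 2 * w ^ 3).
{ split; [rewrite <- Rinv_1; apply Rinv_le_contravar; lra|].
  replace (/ c1) with (1 / c1) by (field; lra). apply div_le_intro; nra. }
assert (hden : 1 / 4 <= (c1 + c2) * c1 * c2).
{ assert (1 / 4 <= c1 * c2) by nra. nra. }
assert (hnum : 0 <= u2 * (u1 + u2) <= 8 * w ^ 4).
{ split; [nra|]. replace (8 * w ^ 4) with ((2 * w ^ 2) * (4 * w ^ 2)) by ring.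
  apply Rmult_le_compat; lra. }
assert (hq : 0 <= u2 * (u1 + u2) / ((c1 + c2) * c1 * c2) <= 32 * w ^ 3).
{ split; [apply Rdiv_le_0_compat; lra|]. apply div_le_intro; [lra|].
  assert (8 * w ^ 4 <= 8 * w ^ 3) by (replace (w ^ 4) with (w * w ^ 3) by ring; nra). nra. }
apply Rabs_le. lra.
Qed.

Lemma energy_mono (p : nat) (K : R) : 0 <= K -> exists Z, 1 <= Z /\
  forall (r1 u1 r2 u2 : R -> R) (a b : R), Z <= a <= b ->
  (forall z, a <= z <= b -> profile p r1 u1 z /\ profile p r2 u2 z /\
    near K r1 u1 z /\ near K r2 u2 z) ->
  a * energy p r1 u1 r2 u2 a <= b * energy p r1 u1 r2 u2 b.
Proof.
intros hK. assert (hp := pos_INR p).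
(* The last summand brings the factor of [du * dx] below 1 in absolute value; the [energy] produced
   by the weight [z] then absorbs that term. *)
set (Z := 8 + 8 * K + 2 * (INR p + 1) * (40 + 8 * K)).
assert (hZ : 0 <= (INR p + 1) * (40 + 8 * K)) by nra.
exists Z. split; [unfold Z; lra|].
intros r1 u1 r2 u2 a b ha hs.
eapply (nondecr_of_derive (fun y => y * energy p r1 u1 r2 u2 y)); [lra | |].
- intros z hz. destruct (hs z hz) as [h1 [h2 _]].
  apply (is_derive_energy p r1 u1 r2 u2 z); [unfold Z in ha; lra | exact h1 | exact h2].
- intros z hz. cbv beta zeta. destruct (hs z hz) as [h1 [h2 [[n1 n2] [n3 n4]]]].
  assert (hz0 : Z <= z) by lra. unfold Z in hz0.
  assert (hz1 : 0 < z) by lra.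
  assert (hw : 0 < / z <= 1 / 8).
  { split; [apply Rinv_0_lt_compat; lra|]. replace (/ z) with (1 / z) by (field; lra).
    apply div_le_intro; lra. }
  assert (hKw : K * / z <= 1 / 8) by (apply (div_le_intro K); lra).
  replace (K / z ^ 3) with (K * (/ z) ^ 3) in n1, n2, n3, n4 by (field; lra).
  replace (/ z ^ 2) with ((/ z) ^ 2) in n2, n4 by (field; lra).
  assert (cs := coupling_small K (/ z) _ _ _ _ hK hw hKw n1 n3 n2 n4).
  destruct (near_bounds K _ _ _ hK hw hKw n1 n2) as [bx1 [bu1 [_ [bc1 hf1]]]].
  destruct (near_bounds K _ _ _ hK hw hKw n3 n4) as [bx2 [bu2 [_ [bc2 hf2]]]].
  unfold energy.
  set (du := u1 z - u2 z). set (dx := z * r1 z - z * r2 z).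
  match goal with |- context [z ^ 2 * (?A - ?B)] => set (g := A - B) end.
  fold g in cs.
  assert (t1 : 0 <= (u1 z + u2 z) / ((cosine (u1 z) + cosine (u2 z)) * (z * r1 z))).
  { apply Rdiv_le_0_compat; nra. }
  assert (t2 : 0 <= 2 * (INR p + 1) * z ^ 2 *
     ((u1 z + u2 z) / ((cosine (u1 z) + cosine (u2 z)) * (z * r1 z))) * du ^ 2).
  { apply Rmult_le_pos; [|apply pow2_ge_0]. apply Rmult_le_pos; [|exact t1].
    apply Rmult_le_pos; [lra | apply pow2_ge_0]. }
  assert (t3 : Rabs (2 * (INR p + 1) * (z ^ 2 * g)) <= 1).
  { rewrite Rabs_mult, (Rabs_pos_eq (2 * (INR p + 1))) by lra.
    rewrite Rabs_mult, (Rabs_pos_eq (z ^ 2)) by apply pow2_ge_0.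
    apply Rle_trans with (2 * (INR p + 1) * (z ^ 2 * ((40 + 8 * K) * (/ z) ^ 3))).
    - apply Rmult_le_compat_l; [lra|]. apply Rmult_le_compat_l; [apply pow2_ge_0 | exact cs].
    - replace (2 * (INR p + 1) * (z ^ 2 * ((40 + 8 * K) * (/ z) ^ 3)))
        with (2 * (INR p + 1) * (40 + 8 * K) / z) by (field; lra).
      apply div_le_intro; lra. }
  revert t2 t3. clearbody g du dx.
  generalize (2 * (INR p + 1) * z ^ 2 *
     ((u1 z + u2 z) / ((cosine (u1 z) + cosine (u2 z)) * (z * r1 z))) * du ^ 2)
     (2 * (INR p + 1) * (z ^ 2 * g)). intros A B hA hB.
  apply Rabs_le_between in hB.
  assert (h3 : - (du ^ 2 + dx ^ 2) <= B * (du * dx)).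
  { assert (s1 := pow2_ge_0 (du - dx)). assert (s2 := pow2_ge_0 (du + dx)). nra. }
  assert (h4 := pow2_ge_0 du). assert (h5 := pow2_ge_0 dx). nra.
Qed.

Lemma near_energy_le (p : nat) (K : R) (r1 u1 r2 u2 : R -> R) (z : R) : 0 <= K -> 1 <= z ->
  near K r1 u1 z -> near K r2 u2 z ->
  z * energy p r1 u1 r2 u2 z <= 4 * (INR p + 2) * K ^ 2 / z ^ 5.
Proof.
intros hK hz [n1 n2] [n3 n4]. assert (hp := pos_INR p). unfold energy.
apply Rabs_le_between in n1. apply Rabs_le_between in n2.
apply Rabs_le_between in n3. apply Rabs_le_between in n4.
assert (hsq : forall y, - (2 * (K / z ^ 3)) <= y <= 2 * (K / z ^ 3) -> y ^ 2 <= 4 * K ^ 2 / z ^ 6).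
{ intros y hy. replace (4 * K ^ 2 / z ^ 6) with ((2 * (K / z ^ 3)) ^ 2) by (field; lra).
  revert hy. generalize (2 * (K / z ^ 3)). intros; nra. }
assert (h1 := hsq (u1 z - u2 z) ltac:(lra)).
assert (h2 := hsq (z * r1 z - z * r2 z) ltac:(lra)).
replace (4 * (INR p + 2) * K ^ 2 / z ^ 5)
  with (z * (4 * K ^ 2 / z ^ 6 + (INR p + 1) * (4 * K ^ 2 / z ^ 6))) by (field; lra).
apply Rmult_le_compat_l; [lra|]. apply Rplus_le_compat; [exact h1|].
apply Rmult_le_compat_l; lra.
Qed.

(** * Lipschitz bounds, Gronwall and uniqueness *)

Lemma field_lipschitz (k u1 u2 r1 r2 : R) : 0 < k <= 1 -> -1 < u1 < 1 -> -1 < u2 < 1 ->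
  k <= cosine u1 -> k <= cosine u2 -> k <= r1 -> k <= r2 ->
  Rabs (u1 / cosine u1 - u2 / cosine u2) <= 2 / k ^ 3 * Rabs (u1 - u2) /\
  Rabs (cosine u1 / r1 - cosine u2 / r2) <= 2 / k ^ 3 * (Rabs (u1 - u2) + Rabs (r1 - r2)).
Proof.
intros hk hu1 hu2 hc1 hc2 hr1 hr2.
destruct (cosine_props _ hu1) as [p1 _]. destruct (cosine_props _ hu2) as [p2 _].
rewrite tangent_sub, curvature_sub by lra.
revert hc1 hc2 p1 p2. generalize (cosine u1) (cosine u2). intros c1 c2 hc1 hc2 p1 p2.
assert (hik : 1 <= / k) by (rewrite <- Rinv_1; apply Rinv_le_contravar; lra).
assert (e3 : 2 / k ^ 3 = 2 * ((/ k) ^ 3)) by (field; lra). rewrite e3.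
set (j := / k) in *.
assert (hj : j <= j ^ 2 /\ j ^ 2 <= j ^ 3) by (split; nra).
assert (inv : forall x, k <= x -> 0 < / x <= j).
{ intros x hx. split; [apply Rinv_0_lt_compat; lra | apply Rinv_le_contravar; lra]. }
assert (i1 := inv c1 hc1). assert (i2 := inv c2 hc2).
assert (i3 := inv r1 hr1). assert (i4 := inv r2 hr2).
assert (hs : Rabs ((u1 + u2) / (c1 + c2)) <= j).
{ unfold Rdiv. rewrite Rabs_mult.
  assert (ha : Rabs (u1 + u2) <= 2) by (apply Rabs_le; lra).
  assert (hb : Rabs (/ (c1 + c2)) <= j / 2).
  { rewrite Rabs_pos_eq; [|apply Rlt_le, Rinv_0_lt_compat; lra].
    unfold j. replace (/ k / 2) with (/ (2 * k)) by (field; lra).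
    apply Rinv_le_contravar; lra. }
  replace j with (2 * (j / 2)) by field.
  apply Rmult_le_compat; auto using Rabs_pos. }
assert (hv : Rabs u2 <= 1) by (apply Rabs_le; lra).
assert (a1 : Rabs (/ c1) <= j) by (rewrite Rabs_pos_eq; lra).
assert (a2 : Rabs (/ c2) <= j) by (rewrite Rabs_pos_eq; lra).
assert (a3 : Rabs (/ r1) <= j) by (rewrite Rabs_pos_eq; lra).
assert (a4 : Rabs (/ r2) <= j) by (rewrite Rabs_pos_eq; lra).
assert (a5 : Rabs c2 <= 1) by (rewrite Rabs_pos_eq; lra).
split.
- rewrite Rabs_mult. apply Rmult_le_compat_r; [apply Rabs_pos|].
  eapply Rle_trans; [apply Rabs_triang|].
  replace (u2 * (u1 + u2) / ((c1 + c2) * c1 * c2))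
    with (u2 * ((u1 + u2) / (c1 + c2)) * (/ c1 * / c2)) by (field; lra).
  assert (b := Rabs_mult_le _ _ _ _ (Rabs_mult_le _ _ _ _ hv hs) (Rabs_mult_le _ _ _ _ a1 a2)).
  nra.
- eapply Rle_trans; [apply (Rabs_triang _ (- _))|]. rewrite !Rabs_Ropp.
  replace ((u1 + u2) / ((c1 + c2) * r1) * (u1 - u2)) with ((u1 + u2) / (c1 + c2) * / r1 * (u1 - u2)) by (field; lra).
  replace (c2 / (r1 * r2) * (r1 - r2)) with (c2 * (/ r1 * / r2) * (r1 - r2)) by (field; lra).
  assert (b1 := Rabs_mult_le _ _ _ _ (Rabs_mult_le _ _ _ _ hs a3) (Rle_refl (Rabs (u1 - u2)))).
  assert (b2 := Rabs_mult_le _ _ _ _ (Rabs_mult_le _ _ _ _ a5 (Rabs_mult_le _ _ _ _ a3 a4)) (Rle_refl (Rabs (r1 - r2)))).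
  assert (h1 := Rabs_pos (u1 - u2)). assert (h2 := Rabs_pos (r1 - r2)).
  assert (hj2 : j * j <= 2 * j ^ 3) by lra.
  assert (b3 := Rmult_le_compat_r _ _ _ h1 hj2). assert (b4 := Rmult_le_compat_r _ _ _ h2 hj2).
  lra.
Qed.

(** The rate covers the worst case: the [r] equation costs at most [L] and the [u] equation at most
    [3 (p+1) L] times the squared distance, where [L = 2 / k^3]. *)
Lemma backward_gronwall (p : nat) (k : R) (r1 u1 r2 u2 : R -> R) (a b : R) : 0 < k <= 1 -> a <= b ->
  (forall z, a <= z <= b -> profile p r1 u1 z /\ profile p r2 u2 z /\
    k <= cosine (u1 z) /\ k <= cosine (u2 z) /\ k <= r1 z /\ k <= r2 z) ->
  (r1 a - r2 a) ^ 2 + (u1 a - u2 a) ^ 2 <=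
    exp (4 * (INR p + 1) * (2 / k ^ 3) * (b - a)) * ((r1 b - r2 b) ^ 2 + (u1 b - u2 b) ^ 2).
Proof.
intros hk hab hs. assert (hp := pos_INR p). set (L := 2 / k ^ 3).
assert (hL : 0 < L) by (apply Rdiv_lt_0_compat; [lra | apply pow_lt; lra]).
set (q := 4 * (INR p + 1) * L).
assert (hm : exp (q * a) * ((r1 a - r2 a) ^ 2 + (u1 a - u2 a) ^ 2) <=
  exp (q * b) * ((r1 b - r2 b) ^ 2 + (u1 b - u2 b) ^ 2)).
{ apply (nondecr_of_derive (fun z => exp (q * z) * ((r1 z - r2 z) ^ 2 + (u1 z - u2 z) ^ 2))
   (fun z => exp (q * z) * (q * ((r1 z - r2 z) ^ 2 + (u1 z - u2 z) ^ 2)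
     - 2 * (r1 z - r2 z) * (u1 z / cosine (u1 z) - u2 z / cosine (u2 z))
     - 2 * (u1 z - u2 z) * ((INR p + 1) * (cosine (u1 z) / r1 z - cosine (u2 z) / r2 z))))); [exact hab | |].
  - intros z hz. destruct (hs z hz) as [[_ [_ [d1 d2]]] [[_ [_ [d3 d4]]] _]].
    auto_derive; [derive_side|]. derive_val d1. derive_val d2. derive_val d3. derive_val d4. ring.
  - intros z hz. destruct (hs z hz) as [[_ [hu1 _]] [[_ [hu2 _]] [hc1 [hc2 [hr1 hr2]]]]].
    destruct (field_lipschitz k _ _ _ _ hk hu1 hu2 hc1 hc2 hr1 hr2) as [l1 l2]. fold L in l1, l2.
    apply Rmult_le_pos; [apply Rlt_le, exp_pos|].
    revert l1 l2. generalize (u1 z / cosine (u1 z) - u2 z / cosine (u2 z))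
      (cosine (u1 z) / r1 z - cosine (u2 z) / r2 z) (u1 z - u2 z) (r1 z - r2 z).
    intros A B v w l1 l2.
    assert (m1 := Rabs_mult_le _ _ _ _ (Rle_refl (Rabs w)) l1).
    assert (m2 := Rabs_mult_le _ _ _ _ (Rle_refl (Rabs v)) l2).
    apply Rabs_le_between in m1. apply Rabs_le_between in m2.
    rewrite <- (pow2_abs v), <- (pow2_abs w).
    assert (hv := Rabs_pos v). assert (hw := Rabs_pos w).
    revert m1 m2 hv hw. generalize (Rabs v) (Rabs w). intros V W m1 m2 hv hw.
    assert (hVW : 2 * (V * W) <= V ^ 2 + W ^ 2) by (assert (h := pow2_ge_0 (V - W)); lra).
    assert (hV2 := pow2_ge_0 V). assert (hW2 := pow2_ge_0 W).
    assert (n1 : L * (2 * (V * W)) <= L * (V ^ 2 + W ^ 2)) by (apply Rmult_le_compat_l; lra).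
    assert (n2 : 2 * (v * ((INR p + 1) * B)) <= (INR p + 1) * (L * (3 * (V ^ 2 + W ^ 2)))).
    { replace (2 * (v * ((INR p + 1) * B))) with ((INR p + 1) * (2 * (v * B))) by ring.
      apply Rmult_le_compat_l; [lra|].
      apply Rle_trans with (L * (2 * V ^ 2 + 2 * (V * W))); [lra|].
      apply Rmult_le_compat_l; lra. }
    assert (n3 : 0 <= INR p * (L * (V ^ 2 + W ^ 2))) by (apply Rmult_le_pos; [lra | nra]).
    unfold q. lra. }
replace (q * (b - a)) with (q * b + - (q * a)) by ring.
rewrite exp_plus, exp_Ropp.
apply (Rmult_le_reg_l (exp (q * a))); [apply exp_pos|].
eapply Rle_trans; [exact hm|]. right. field. apply Rgt_not_eq, exp_pos.
Qed.

(** The point is that [k] depends on [a] and [f] only, hence is common to whole families of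
    solutions. *)
Lemma region_bound (p : nat) (a f : R) : 0 < a -> 0 < f -> exists k, 0 < k <= 1 /\
  forall (r u : R -> R) (z : R), a <= z -> profile p r u z -> f <= flux p r u z ->
  k <= cosine (u z) /\ k <= r z.
Proof.
intros ha hf. assert (h2a : 0 < 2 / a) by (apply Rdiv_lt_0_compat; lra).
assert (q1 := pow_lt (2 / a) p h2a). assert (q2 := pow_lt (2 / a) (S p) h2a).
set (k := Rmin 1 (Rmin (f / (2 / a) ^ p) (f / (2 / a) ^ S p))).
assert (m1 := Rmin_l 1 (Rmin (f / (2 / a) ^ p) (f / (2 / a) ^ S p))).
assert (m2 := Rmin_r 1 (Rmin (f / (2 / a) ^ p) (f / (2 / a) ^ S p))).
assert (m3 := Rmin_l (f / (2 / a) ^ p) (f / (2 / a) ^ S p)).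
assert (m4 := Rmin_r (f / (2 / a) ^ p) (f / (2 / a) ^ S p)).
fold k in m1, m2.
exists k. split.
- split; [|exact m1]. apply Rmin_glb_lt; [lra|].
  apply Rmin_glb_lt; apply Rdiv_lt_0_compat; assumption.
- intros r u z hz hpr hF.
  destruct (flux_region p r u a z f ltac:(lra) hpr ltac:(lra)) as [h1 h2].
  assert (h3 : f / (2 / a) ^ p <= r z) by (apply div_le_intro; assumption).
  assert (h4 : f / (2 / a) ^ S p <= cosine (u z)) by (apply div_le_intro; assumption).
  lra.
Qed.

Lemma profile_unique (p : nat) (r1 u1 r2 u2 : R -> R) :
  (forall z, 0 < z -> profile p r1 u1 z) -> (forall z, 0 < z -> profile p r2 u2 z) ->
  forall z, 0 < z -> r1 z = r2 z /\ u1 z = u2 z.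
Proof.
intros hs1 hs2. assert (hp := pos_INR p).
destruct (near_global p) as [K [Z [hK [hZ hnear]]]].
destruct (energy_mono p K hK) as [Z' [hZ' hmono]].
assert (far : forall z, Rmax Z Z' <= z -> (r1 z - r2 z) ^ 2 + (u1 z - u2 z) ^ 2 <= 0).
{ intros z hz. assert (z1 := Rmax_l Z Z'). assert (z2 := Rmax_r Z Z').
  apply Rnot_lt_le. intros hlt.
  assert (hE := energy_ge p r1 u1 r2 u2 z ltac:(lra)).
  set (d := (r1 z - r2 z) ^ 2 + (u1 z - u2 z) ^ 2) in *.
  set (C := 4 * (INR p + 2) * K ^ 2). assert (hC : 0 <= C) by (unfold C; nra).
  assert (hCd : 0 <= C / d) by (apply Rdiv_le_0_compat; lra).
  (* Since [b > C / d], the chain [d <= z E(z) <= b E(b) <= C / b^5 <= C / b < d] is absurd. *)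
  set (b := z + C / d + 1).
  assert (hb := hmono r1 u1 r2 u2 z b ltac:(unfold b; lra)
    (fun y hy => conj (hs1 y ltac:(lra)) (conj (hs2 y ltac:(lra))
      (conj (hnear r1 u1 hs1 y ltac:(lra)) (hnear r2 u2 hs2 y ltac:(lra)))))).
  assert (hb1 : 1 <= b) by (unfold b; lra).
  assert (hbE := near_energy_le p K r1 u1 r2 u2 b hK hb1
    (hnear r1 u1 hs1 b ltac:(unfold b; lra)) (hnear r2 u2 hs2 b ltac:(unfold b; lra))).
  fold C in hbE.
  assert (hlast : C / b ^ 5 <= C / b).
  { apply Rmult_le_compat_l; [exact hC|]. apply Rinv_le_contravar; [lra|].
    assert (h := Rle_pow b 1 5 hb1 ltac:(lia)). lra. }
  assert (hfin : C / b < d).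
  { apply (Rmult_lt_reg_r b); [lra|]. replace (C / b * b) with C by (field; lra).
    replace C with (d * (C / d)) at 1 by (field; lra).
    apply Rmult_lt_compat_l; [lra|]. unfold b; lra. }
  lra. }
assert (all : forall z, 0 < z -> (r1 z - r2 z) ^ 2 + (u1 z - u2 z) ^ 2 <= 0).
{ intros z hz. destruct (Rle_lt_dec (Rmax Z Z') z) as [hl|hl]; [exact (far z hl)|].
  set (b := Rmax Z Z') in *.
  (* Below [b] the fluxes only increase as the height decreases, so their values at [b] give one
     region for both solutions and Gronwall carries the coincidence down. *)
  assert (f1 := flux_pos p r1 u1 hs1 b ltac:(lra)). assert (f2 := flux_pos p r2 u2 hs2 b ltac:(lra)).
  destruct (region_bound p z (Rmin (flux p r1 u1 b) (flux p r2 u2 b)) hz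
    ltac:(apply Rmin_glb_lt; assumption)) as [k [hk hreg]].
  assert (g := backward_gronwall p k r1 u1 r2 u2 z b hk ltac:(lra)).
  assert (fb := far b ltac:(lra)).
  assert (m1 := Rmin_l (flux p r1 u1 b) (flux p r2 u2 b)).
  assert (m2 := Rmin_r (flux p r1 u1 b) (flux p r2 u2 b)).
  eapply Rle_trans; [apply g|].
  - intros y hy. assert (p1 := hs1 y ltac:(lra)). assert (p2 := hs2 y ltac:(lra)).
    assert (d1 := flux_decr p r1 u1 y b ltac:(lra) (fun x hx => hs1 x ltac:(lra))).
    assert (d2 := flux_decr p r2 u2 y b ltac:(lra) (fun x hx => hs2 x ltac:(lra))).
    destruct (hreg r1 u1 y ltac:(lra) p1 ltac:(lra)). destruct (hreg r2 u2 y ltac:(lra) p2 ltac:(lra)).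
    tauto.
  - assert (he := exp_pos (4 * (INR p + 1) * (2 / k ^ 3) * (b - z))). nra. }
intros z hz. specialize (all z hz).
assert (h1 := pow2_ge_0 (r1 z - r2 z)). assert (h2 := pow2_ge_0 (u1 z - u2 z)).
assert (h3 : r1 z - r2 z = 0) by nra. assert (h4 : u1 z - u2 z = 0) by nra. lra.
Qed.

(** * Limits of functions and Picard iteration *)

Lemma cauchy_rate (v e : nat -> R) (N : nat) : is_lim_seq e 0 ->
  (forall n j, (N <= n)%nat -> Rabs (v (n + j)%nat - v n) <= e n) ->
  forall n, (N <= n)%nat -> Rabs (v n - real (Lim_seq v)) <= e n.
Proof.
intros he hv.
assert (hc : ex_finite_lim_seq v).
{ apply ex_lim_seq_cauchy_corr. intros eps.
  destruct (proj2 (is_lim_seq_spec e 0) he (mkposreal _ (is_pos_div_2 eps))) as [N1 h1].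
  simpl in h1. exists (N + N1)%nat. intros n m hn hm.
  assert (h2 := hv (N + N1)%nat (n - (N + N1))%nat ltac:(lia)).
  assert (h3 := hv (N + N1)%nat (m - (N + N1))%nat ltac:(lia)).
  replace (N + N1 + (n - (N + N1)))%nat with n in h2 by lia.
  replace (N + N1 + (m - (N + N1)))%nat with m in h3 by lia.
  specialize (h1 (N + N1)%nat ltac:(lia)). rewrite Rminus_0_r in h1.
  apply Rabs_lt_between in h1. apply Rabs_le_between in h2. apply Rabs_le_between in h3.
  apply Rabs_lt_between. lra. }
apply Lim_seq_correct' in hc.
intros n hn. apply (is_lim_seq_incr_n _ n) in hc.
assert (h : is_lim_seq (fun j => Rabs (v n - v (j + n)%nat)) (Rabs (v n - real (Lim_seq v)))).
{ apply (is_lim_seq_abs _ (Finite _)). apply is_lim_seq_minus'; [apply is_lim_seq_const | exact hc]. }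
refine (is_lim_seq_le _ _ _ _ _ h (is_lim_seq_const (e n))).
intros j. rewrite Rabs_minus_sym, Nat.add_comm. apply hv, hn.
Qed.

(** The sequence is shifted by [N] because the bounds start there, whereas [CVU_derivable] wants
    derivatives for every index. *)
Lemma derive_limit (fn dfn : nat -> R -> R) (f df : R -> R) (c : R) (d : posreal) (e : nat -> R) (N : nat) :
  is_lim_seq e 0 ->
  (forall n y, (N <= n)%nat -> Rabs (y - c) < d ->
    is_derive (fn n) y (dfn n y) /\ Rabs (fn n y - f y) <= e n /\
    Rabs (dfn n y - df y) <= e n) ->
  is_derive f c (df c).
Proof.
intros he h.
assert (hsmall : forall eps, 0 < eps -> exists N1, forall n, (N1 <= n)%nat -> Rabs (e (N + n)%nat) < eps).
{ intros eps heps. destruct (proj2 (is_lim_seq_spec e 0) he (mkposreal eps heps)) as [N1 h1].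
  simpl in h1. exists N1. intros n hn. rewrite <- (Rminus_0_r (e (N + n)%nat)). apply h1. lia. }
assert (hu : CVU (fun n => dfn (N + n)%nat) df c d).
{ intros eps heps. destruct (hsmall eps heps) as [N1 h1]. exists N1. intros n y hn hy.
  destruct (h (N + n)%nat y ltac:(lia) hy) as [_ [_ h2]].
  specialize (h1 n hn). apply Rabs_lt_between in h1. rewrite Rabs_minus_sym. lra. }
apply is_derive_Reals.
apply (CVU_derivable (fun n => fn (N + n)%nat) (fun n => dfn (N + n)%nat) f df c d); [exact hu | | |].
- intros y hy eps heps. destruct (hsmall eps heps) as [N1 h1]. exists N1. intros n hn.
  destruct (h (N + n)%nat y ltac:(lia) hy) as [_ [h2 _]].
  specialize (h1 n hn). apply Rabs_lt_between in h1. unfold Rdist. lra.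
- intros n y hy. apply is_derive_Reals. apply (h (N + n)%nat y ltac:(lia) hy).
- unfold Boule. rewrite Rminus_diag, Rabs_R0. apply cond_pos.
Qed.

(** The time variable is included so that the field along continuous curves is continuous, as
    [primitive] requires. *)
Definition jointly_lipschitz (L : R) (f : R -> R -> R -> R) : Prop :=
  forall t x y t' x' y',
    Rabs (f t x y - f t' x' y') <= L * (Rabs (t - t') + Rabs (x - x') + Rabs (y - y')).

Lemma jointly_lipschitz_continuous (L : R) (f : R -> R -> R -> R) (X Y : R -> R) (t : R) : 0 < L ->
  jointly_lipschitz L f -> continuous X t -> continuous Y t ->
  continuous (fun s => f s (X s) (Y s)) t.
Proof.
intros hL hf hX hY. apply filterlim_locally. intros eps.
assert (he : 0 < eps / (3 * L)) by (apply Rdiv_lt_0_compat; [apply cond_pos | lra]).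
assert (h1 := proj1 (filterlim_locally _ _) hX (mkposreal _ he)).
assert (h2 := proj1 (filterlim_locally _ _) hY (mkposreal _ he)).
assert (h3 : locally t (fun s => Rabs (s - t) < eps / (3 * L))) by (exists (mkposreal _ he); intros s hs; exact hs).
generalize (filter_and _ _ h1 (filter_and _ _ h2 h3)). apply filter_imp.
intros s [a1 [a2 a3]].
change (Rabs (X s - X t) < eps / (3 * L)) in a1. change (Rabs (Y s - Y t) < eps / (3 * L)) in a2.
change (Rabs (f s (X s) (Y s) - f t (X t) (Y t)) < eps).
eapply Rle_lt_trans; [apply hf|].
replace (pos eps) with (L * (eps / (3 * L) + eps / (3 * L) + eps / (3 * L))) by (field; lra).
apply Rmult_lt_compat_l; lra.
Qed.

Definition primitive (t0 c : R) (f : R -> R) (t : R) : R := c + RInt f t0 t.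

Lemma is_derive_primitive (t0 c : R) (f : R -> R) : (forall t, continuous f t) ->
  primitive t0 c f t0 = c /\ forall t, is_derive (primitive t0 c f) t (f t).
Proof.
intros hf. split.
- unfold primitive. rewrite RInt_point. apply Rplus_0_r.
- intros t. unfold primitive. rewrite <- (Rplus_0_l (f t)).
  apply (is_derive_plus (fun _ : R => c) (fun s => RInt f t0 s) t 0 (f t)); [apply is_derive_Reals, derivable_pt_lim_const|].
  apply (is_derive_RInt f _ t0 t); [|apply hf].
  exists (mkposreal 1 Rlt_0_1). intros s _.
  apply (@RInt_correct R_CompleteNormedModule), (@ex_RInt_continuous R_CompleteNormedModule).
  intros; apply hf.
Qed.

Lemma exp_mono (x y : R) : x <= y -> exp x <= exp y.
Proof. intros [h | ->]; [apply Rlt_le, exp_increasing, h | apply Rle_refl]. Qed.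

(* With [q = 4 L] this makes the Picard map a contraction on the whole line. *)
Lemma exp_growth (w dw : R -> R) (t0 A q : R) : 0 < q -> 0 <= A -> w t0 = 0 ->
  (forall t, is_derive w t (dw t)) -> (forall t, Rabs (dw t) <= A * exp (q * Rabs (t - t0))) ->
  forall t, Rabs (w t) <= A / q * exp (q * Rabs (t - t0)).
Proof.
intros hq hA h0 hd hb t.
assert (hAq : 0 <= A / q) by (apply Rdiv_le_0_compat; lra).
destruct (Rle_lt_dec t0 t) as [ht|ht].
- assert (ub : forall sg, (sg = 1 \/ sg = -1) -> A / q * exp (q * (t0 - t0)) - sg * w t0 <= A / q * exp (q * (t - t0)) - sg * w t).
  { intros sg hsg. apply (nondecr_of_derive (fun s => A / q * exp (q * (s - t0)) - sg * w s)
      (fun s => A * exp (q * (s - t0)) - sg * dw s)); [exact ht | |].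
    - intros s hs. assert (d := hd s). auto_derive; [derive_side|]. derive_val d. unfold Rminus. field. lra.
    - intros s hs. specialize (hb s). rewrite (Rabs_pos_eq (s - t0)) in hb by lra.
      apply Rabs_le_between in hb. destruct hsg as [-> | ->]; lra. }
  rewrite (Rabs_pos_eq (t - t0)) by lra.
  assert (u1 := ub 1 (or_introl eq_refl)). assert (u2 := ub (-1) (or_intror eq_refl)).
  assert (0 <= A / q * exp (q * (t0 - t0))) by (apply Rmult_le_pos; [lra | apply Rlt_le, exp_pos]).
  rewrite h0 in u1, u2. apply Rabs_le. lra.
- assert (ub : forall sg, (sg = 1 \/ sg = -1) -> - (A / q * exp (q * (t0 - t))) - sg * w t <= - (A / q * exp (q * (t0 - t0))) - sg * w t0).
  { intros sg hsg. apply (nondecr_of_derive (fun s => - (A / q * exp (q * (t0 - s))) - sg * w s)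
      (fun s => A * exp (q * (t0 - s)) - sg * dw s)); [lra | |].
    - intros s hs. assert (d := hd s). auto_derive; [derive_side|]. derive_val d. unfold Rminus. field. lra.
    - intros s hs. specialize (hb s). rewrite (Rabs_left1 (s - t0)) in hb by lra.
      replace (- (s - t0)) with (t0 - s) in hb by ring.
      apply Rabs_le_between in hb. destruct hsg as [-> | ->]; lra. }
  rewrite (Rabs_left1 (t - t0)) by lra. replace (- (t - t0)) with (t0 - t) by ring.
  assert (u1 := ub 1 (or_introl eq_refl)). assert (u2 := ub (-1) (or_intror eq_refl)).
  assert (0 <= A / q * exp (q * (t0 - t0))) by (apply Rmult_le_pos; [lra | apply Rlt_le, exp_pos]).
  rewrite h0 in u1, u2. apply Rabs_le. lra.
Qed.

Lemma geometric_gap (v : nat -> R) (E : R) :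
  (forall k, Rabs (v (S k) - v k) <= E * (1 / 2) ^ k) ->
  forall n j, Rabs (v (n + j)%nat - v n) <= 2 * E * (1 / 2) ^ n.
Proof.
intros h n j.
assert (hE : 0 <= E) by (assert (h0 := h 0%nat); simpl in h0; assert (h1 := Rabs_pos (v 1%nat - v 0%nat)); lra).
assert (hg : Rabs (v (n + j)%nat - v n) <= 2 * E * ((1 / 2) ^ n - (1 / 2) ^ (n + j))).
{ induction j as [|j IH].
  - rewrite Nat.add_0_r, !Rminus_diag, Rabs_R0. lra.
  - rewrite Nat.add_succ_r.
    replace (v (S (n + j)) - v n) with ((v (S (n + j)) - v (n + j)%nat) + (v (n + j)%nat - v n)) by ring.
    eapply Rle_trans; [apply Rabs_triang|]. assert (h1 := h (n + j)%nat).
    rewrite <- (tech_pow_Rmult (1 / 2) (n + j)). lra. }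
assert (h2 : 0 <= (1 / 2) ^ (n + j)) by (apply pow_le; lra). nra.
Qed.

Lemma is_lim_seq_half_pow (C : R) : is_lim_seq (fun n => C * (1 / 2) ^ n) 0.
Proof.
replace (Finite 0) with (Rbar_mult C 0) by (simpl; f_equal; ring).
apply is_lim_seq_scal_l, is_lim_seq_geom. rewrite Rabs_pos_eq; lra.
Qed.

Fixpoint picard_iter (f g : R -> R -> R -> R) (t0 x0 y0 : R) (n : nat) : (R -> R) * (R -> R) :=
  match n with
  | O => (fun _ => x0, fun _ => y0)
  | S n => let XY := picard_iter f g t0 x0 y0 n in
      (primitive t0 x0 (fun s => f s (fst XY s) (snd XY s)),
       primitive t0 y0 (fun s => g s (fst XY s) (snd XY s)))
  end.

Lemma picard (f g : R -> R -> R -> R) (L B t0 x0 y0 : R) : 0 < L -> 0 <= B ->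
  jointly_lipschitz L f -> jointly_lipschitz L g ->
  (forall t x y, Rabs (f t x y) <= B) -> (forall t x y, Rabs (g t x y) <= B) ->
  exists X Y : R -> R, X t0 = x0 /\ Y t0 = y0 /\
    forall t, is_derive X t (f t (X t) (Y t)) /\ is_derive Y t (g t (X t) (Y t)).
Proof.
intros hL hB hf hg bf bg.
set (X := fun n => fst (picard_iter f g t0 x0 y0 n)).
set (Y := fun n => snd (picard_iter f g t0 x0 y0 n)).
assert (hc : forall n t, continuous (X n) t /\ continuous (Y n) t).
{ induction n as [|n IH]; intros t.
  - split; apply continuous_const.
  - split; apply (ex_derive_continuous (V := R_NormedModule)); eexists;
      refine (proj2 (is_derive_primitive _ _ _ _) t);
      intros s; apply (jointly_lipschitz_continuous L); try assumption; apply IH. }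
assert (dX : forall n t, is_derive (X (S n)) t (f t (X n t) (Y n t))).
{ intros n t. refine (proj2 (is_derive_primitive t0 x0 (fun s => f s (X n s) (Y n s)) _) t).
  intros s. apply (jointly_lipschitz_continuous L); try assumption; apply hc. }
assert (dY : forall n t, is_derive (Y (S n)) t (g t (X n t) (Y n t))).
{ intros n t. refine (proj2 (is_derive_primitive t0 y0 (fun s => g s (X n s) (Y n s)) _) t).
  intros s. apply (jointly_lipschitz_continuous L); try assumption; apply hc. }
assert (iX : forall n, X n t0 = x0).
{ intros [|n]; [reflexivity|]. unfold X. simpl. unfold primitive. rewrite RInt_point. apply Rplus_0_r. }
assert (iY : forall n, Y n t0 = y0).
{ intros [|n]; [reflexivity|]. unfold Y. simpl. unfold primitive. rewrite RInt_point. apply Rplus_0_r. }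
(* The first increment has derivative at most [B], so [exp_growth] with [q = 4 L] bounds it by [D]
   times the weight [w]. *)
set (D := B / (4 * L)). assert (hD : 0 <= D) by (apply Rdiv_le_0_compat; lra).
set (w := fun t => exp (4 * L * Rabs (t - t0))).
assert (hw : forall t, 1 <= w t).
{ intros t. assert (h := Rabs_pos (t - t0)).
  unfold w. rewrite <- exp_0. apply exp_mono. nra. }
assert (step : forall n t, Rabs (X (S n) t - X n t) <= D * (1 / 2) ^ n * w t /\
                           Rabs (Y (S n) t - Y n t) <= D * (1 / 2) ^ n * w t).
{ induction n as [|n IH].
  - assert (base : forall (Z z : R -> R) (c : R), (forall s, is_derive Z s (z s)) -> Z t0 = c ->
      (forall s, Rabs (z s) <= B) -> forall t, Rabs (Z t - c) <= D * (1 / 2) ^ 0 * w t).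
    { intros Z z c dZ hZ hz t. rewrite Rmult_1_r.
      apply (exp_growth (fun s => Z s - c) z t0 B (4 * L)); [lra | exact hB | lra | |].
      - intros s. assert (d := dZ s). auto_derive; [derive_side|]. derive_val d. ring.
      - intros s. specialize (hz s). assert (h := hw s). unfold w in h. nra. }
    intros t. split.
    + exact (base (X 1%nat) _ x0 (dX 0%nat) (iX 1%nat) (fun s => bf _ _ _) t).
    + exact (base (Y 1%nat) _ y0 (dY 0%nat) (iY 1%nat) (fun s => bg _ _ _) t).
  (* Two increments of size [D (1/2)^n] times the weight pass through the Lipschitz bound, and
     division by [q = 4 L] leaves the ratio [1/2]. *)
  - set (A := L * (2 * (D * (1 / 2) ^ n))).
    assert (hA : 0 <= A).
    { assert (h := pow_le (1 / 2) n ltac:(lra)). unfold A. apply Rmult_le_pos; [lra | nra]. }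
    assert (hAe : A / (4 * L) = D * (1 / 2) ^ S n) by (unfold A; simpl; field; lra).
    assert (ind : forall (h : R -> R -> R -> R) (Z1 Z0 : R -> R), jointly_lipschitz L h ->
      (forall s, is_derive Z1 s (h s (X (S n) s) (Y (S n) s))) ->
      (forall s, is_derive Z0 s (h s (X n s) (Y n s))) -> Z1 t0 = Z0 t0 ->
      forall t, Rabs (Z1 t - Z0 t) <= D * (1 / 2) ^ S n * w t).
    { intros h Z1 Z0 hh d1 d0 h0 t. rewrite <- hAe.
      apply (exp_growth (fun s => Z1 s - Z0 s)
        (fun s => h s (X (S n) s) (Y (S n) s) - h s (X n s) (Y n s)) t0 A (4 * L)); [lra | exact hA | lra | |].
      - intros s. assert (e1 := d1 s). assert (e0 := d0 s).
        auto_derive; [derive_side|]. derive_val e1. derive_val e0. ring.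
      - intros s. eapply Rle_trans; [apply hh|]. rewrite Rminus_diag, Rabs_R0.
        destruct (IH s) as [i1 i2]. unfold A. fold (w s).
        replace (L * (2 * (D * (1 / 2) ^ n)) * w s)
          with (L * (0 + D * (1 / 2) ^ n * w s + D * (1 / 2) ^ n * w s)) by ring.
        apply Rmult_le_compat_l; lra. }
    intros t. split.
    + apply (ind f); [exact hf | apply dX | apply dX | rewrite !iX; reflexivity].
    + apply (ind g); [exact hg | apply dY | apply dY | rewrite !iY; reflexivity]. }
set (XL := fun t => real (Lim_seq (fun n => X n t))).
set (YL := fun t => real (Lim_seq (fun n => Y n t))).
assert (lX : forall n t, Rabs (X n t - XL t) <= 2 * (D * w t) * (1 / 2) ^ n).
{ intros n t. apply (cauchy_rate (fun n => X n t) (fun n => 2 * (D * w t) * (1 / 2) ^ n) 0);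
    [apply is_lim_seq_half_pow | | lia].
  intros m j _. apply (geometric_gap (fun n => X n t)). intros k. destruct (step k t) as [h _]. lra. }
assert (lY : forall n t, Rabs (Y n t - YL t) <= 2 * (D * w t) * (1 / 2) ^ n).
{ intros n t. apply (cauchy_rate (fun n => Y n t) (fun n => 2 * (D * w t) * (1 / 2) ^ n) 0);
    [apply is_lim_seq_half_pow | | lia].
  intros m j _. apply (geometric_gap (fun n => Y n t)). intros k. destruct (step k t) as [_ h]. lra. }
assert (der : forall (h : R -> R -> R -> R) (Z : nat -> R -> R) (ZL : R -> R), jointly_lipschitz L h ->
  (forall n s, is_derive (Z (S n)) s (h s (X n s) (Y n s))) ->
  (forall n t, Rabs (Z n t - ZL t) <= 2 * (D * w t) * (1 / 2) ^ n) ->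
  forall t, is_derive ZL t (h t (XL t) (YL t))).
{ intros h Z ZL hh dZ lZ t.
  (* The weight is unbounded on the line; [W] dominates it on the unit ball around [t], which is
     enough for a derivative at [t]. *)
  set (W := exp (4 * L * (Rabs (t - t0) + 1))).
  apply (derive_limit (fun n => Z (S n)) (fun n s => h s (X n s) (Y n s)) ZL
    (fun s => h s (XL s) (YL s)) t (mkposreal 1 Rlt_0_1)
    (fun n => (1 + 2 * L) * (2 * (D * W)) * (1 / 2) ^ n) 0); [apply is_lim_seq_half_pow|].
  intros n s _ hs. simpl in hs.
  assert (hW : w s <= W).
  { apply exp_mono. apply Rmult_le_compat_l; [lra|].
    replace (s - t0) with ((s - t) + (t - t0)) by ring.
    assert (h1 := Rabs_triang (s - t) (t - t0)). lra. }
  assert (hn := pow_le (1 / 2) n ltac:(lra)).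
  assert (hDW : 2 * (D * w s) * (1 / 2) ^ n <= 2 * (D * W) * (1 / 2) ^ n).
  { apply Rmult_le_compat_r; [exact hn|]. apply Rmult_le_compat_l; [lra|].
    apply Rmult_le_compat_l; lra. }
  assert (hpos : 0 <= 2 * (D * W) * (1 / 2) ^ n).
  { apply Rmult_le_pos; [|exact hn]. assert (h1 := hw s). nra. }
  set (G := 2 * (D * W) * (1 / 2) ^ n) in *.
  replace ((1 + 2 * L) * (2 * (D * W)) * (1 / 2) ^ n) with (G + 2 * L * G) by (unfold G; ring).
  assert (hLG : 0 <= L * G) by nra.
  split; [apply dZ|]. split.
  - assert (h1 := lZ (S n) s). rewrite <- (tech_pow_Rmult (1 / 2) n) in h1.
    assert (h2 := Rmult_le_pos _ _ hD (Rle_trans _ _ _ Rle_0_1 (hw s))).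
    assert (h3 := Rmult_le_pos _ _ h2 hn). lra.
  - eapply Rle_trans; [apply hh|]. rewrite Rminus_diag, Rabs_R0.
    apply Rle_trans with (L * (0 + G + G)); [|lra]. apply Rmult_le_compat_l; [lra|].
    assert (h1 := lX n s). assert (h2 := lY n s). lra. }
exists XL, YL. split; [|split].
- unfold XL. rewrite (Lim_seq_ext _ (fun _ => x0)); [now rewrite Lim_seq_const | intros; apply iX].
- unfold YL. rewrite (Lim_seq_ext _ (fun _ => y0)); [now rewrite Lim_seq_const | intros; apply iY].
- intros t. split; [apply (der f X) | apply (der g Y)]; assumption.
Qed.

(** * Backward solvability from data with positive flux *)

Definition clip (a b y : R) : R := Rmax a (Rmin y b).

Lemma clip_lipschitz (a b y y' : R) : Rabs (clip a b y - clip a b y') <= Rabs (y - y').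
Proof.
unfold clip, Rmax, Rmin. repeat destruct Rle_dec; unfold Rabs; repeat destruct Rcase_abs; lra.
Qed.

Lemma clip_in (a b y : R) : a <= b -> a <= clip a b y <= b.
Proof. intros hab. unfold clip, Rmax, Rmin. repeat destruct Rle_dec; lra. Qed.

Lemma clip_id (a b y : R) : a <= y <= b -> clip a b y = y.
Proof. intros h. unfold clip, Rmax, Rmin. repeat destruct Rle_dec; lra. Qed.

Lemma Rmax_lipschitz (k x x' : R) : Rabs (Rmax x k - Rmax x' k) <= Rabs (x - x').
Proof. unfold Rmax. repeat destruct Rle_dec; unfold Rabs; repeat destruct Rcase_abs; lra. Qed.

Lemma continuity_pt_pos (h : R -> R) (s : R) : continuity_pt h s -> 0 < h s ->
  exists d, 0 < d /\ forall y, Rabs (y - s) < d -> 0 < h y.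
Proof.
intros hc hs. destruct (hc (h s) hs) as [d [hd hy]]. exists d. split; [exact hd|].
intros y hyd. destruct (Req_dec y s) as [->|hne]; [exact hs|].
assert (hv := hy y (conj (conj I (fun e => hne (eq_sym e))) hyd)).
simpl in hv. unfold Rdist in hv. apply Rabs_lt_between in hv. lra.
Qed.

(* Running down from [b], neither [h1] nor [h2] can be the first to vanish. *)
Lemma backward_barrier (h1 h2 : R -> R) (a b : R) : a <= b ->
  (forall z, continuity_pt h1 z) -> (forall z, continuity_pt h2 z) ->
  0 < h1 b -> 0 < h2 b ->
  (forall s, a <= s <= b -> (forall z, s <= z <= b -> 0 <= h1 z /\ 0 <= h2 z) -> 0 < h1 s /\ 0 < h2 s) ->
  forall z, a <= z <= b -> 0 < h1 z /\ 0 < h2 z.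
Proof.
intros hab c1 c2 b1 b2 hbar z0 hz0. apply Classical_Prop.NNPP. intros hbad.
(* The supremum of [E] is the first bad height met when descending from [b]. *)
set (E := fun z => z0 <= z <= b /\ ~ (0 < h1 z /\ 0 < h2 z)).
destruct (completeness E) as [s [hub hlub]].
- exists b. intros z [hz _]; lra.
- exists z0. split; [lra | exact hbad].
- assert (hs0 : z0 <= s) by (apply hub; split; [lra | exact hbad]).
  assert (hsb : s <= b) by (apply hlub; intros z [hz _]; lra).
  assert (good : forall z, s < z <= b -> 0 < h1 z /\ 0 < h2 z).
  { intros z hz. apply Classical_Prop.NNPP. intros hn.
    assert (z <= s) by (apply hub; split; [lra | exact hn]). lra. }
  assert (hsbad : ~ (0 < h1 s /\ 0 < h2 s)).
  { intros [g1 g2]. destruct (continuity_pt_pos h1 s (c1 s) g1) as [d1 [hd1 n1]].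
    destruct (continuity_pt_pos h2 s (c2 s) g2) as [d2 [hd2 n2]].
    assert (m1 := Rmin_l d1 d2). assert (m2 := Rmin_r d1 d2).
    assert (m3 : 0 < Rmin d1 d2) by (apply Rmin_glb_lt; assumption).
    assert (s <= s - Rmin d1 d2 / 2); [|lra].
    apply hlub. intros z [hz hzb]. apply Rnot_lt_le. intros hlt. apply hzb.
    assert (z <= s) by (apply hub; split; assumption).
    split; [apply n1 | apply n2]; apply Rabs_lt_between; lra. }
  assert (hlt : s < b).
  { destruct hsb as [h | h]; [exact h|]. subst s. exfalso. apply hsbad. tauto. }
  assert (nonneg : forall h : R -> R, continuity_pt h s -> (forall z, s < z <= b -> 0 < h z) -> 0 <= h s).
  { intros h hc hp. apply Rnot_lt_le. intros hn.
    destruct (continuity_pt_pos (fun z => - h z) s) as [d [hd n]]; [apply continuity_pt_opp, hc | lra |].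
    assert (m1 := Rmin_l (d / 2) (b - s)). assert (m2 := Rmin_r (d / 2) (b - s)).
    assert (m3 : 0 < Rmin (d / 2) (b - s)) by (apply Rmin_glb_lt; lra).
    assert (q1 := hp (s + Rmin (d / 2) (b - s)) ltac:(lra)).
    assert (q2 := n (s + Rmin (d / 2) (b - s)) ltac:(apply Rabs_lt_between; lra)).
    simpl in q2. lra. }
  apply hsbad, hbar; [lra|]. intros z hz.
  destruct (Req_dec z s) as [->|hne].
  + split; apply nonneg; auto; intros z' hz'; apply (good z' hz').
  + destruct (good z ltac:(lra)). lra.
Qed.

Lemma cosine_ge (k y : R) : 0 < k <= 1 -> - sqrt (1 - k ^ 2) <= y <= sqrt (1 - k ^ 2) ->
  -1 < y < 1 /\ k <= cosine y.
Proof.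
intros hk hy. assert (hs : 0 <= 1 - k ^ 2) by nra.
assert (h1 := sqrt_pos (1 - k ^ 2)). assert (h2 := pow2_sqrt (1 - k ^ 2) hs).
revert hy h1 h2. generalize (sqrt (1 - k ^ 2)). intros m hy h1 h2.
assert (hm : m < 1) by nra. assert (hy2 : 0 <= (m - y) * (m + y)) by (apply Rmult_le_pos; lra).
assert (hy1 : -1 < y < 1) by lra. split; [exact hy1|].
destruct (cosine_props y hy1) as [hc [hc2 _]]. nra.
Qed.

Lemma lt_sqrt_of_cosine (k y : R) : 0 < k <= 1 -> -1 < y < 1 -> k < cosine y ->
  - sqrt (1 - k ^ 2) < y < sqrt (1 - k ^ 2).
Proof.
intros hk hy hc. destruct (cosine_props y hy) as [h1 [h2 _]].
assert (hs : 0 <= 1 - k ^ 2) by nra.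
assert (h3 := sqrt_pos (1 - k ^ 2)). assert (h4 := pow2_sqrt (1 - k ^ 2) hs).
revert h3 h4. generalize (sqrt (1 - k ^ 2)). intros m h3 h4.
assert (hy2 : y ^ 2 < m ^ 2) by nra. split; nra.
Qed.

(** The constant functions only express the flux of the data. The field is truncated in [u], [r] and
    [z] to become bounded and Lipschitz on the whole space; as long as the truncation is inactive,
    the flux stays above its value at [b], which keeps the solution strictly inside the untruncated
    region. *)
Lemma profile_backward (p : nat) (a b x0 u0 : R) : 0 < a <= b -> 0 < x0 -> -1 < u0 < 1 ->
  0 < flux p (fun _ => x0) (fun _ => u0) b ->
  exists r u : R -> R, r b = x0 /\ u b = u0 /\ forall z, a <= z <= b -> profile p r u z.
Proof.
intros hab hx0 hu0 hF. assert (hp := pos_INR p).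
destruct (region_bound p a _ (proj1 hab) hF) as [k1 [hk1 hreg]].
destruct (cosine_props u0 hu0) as [hc0 _].
(* Halving makes [k] strictly smaller than the bound [k1] granted by the flux and than the initial
   values, so the barrier is never touched. *)
set (k := Rmin k1 (Rmin x0 (cosine u0)) / 2).
assert (hk : 0 < k <= 1 /\ k < k1 /\ k < x0 /\ k < cosine u0).
{ assert (m1 := Rmin_l k1 (Rmin x0 (cosine u0))). assert (m2 := Rmin_r k1 (Rmin x0 (cosine u0))).
  assert (m3 := Rmin_l x0 (cosine u0)). assert (m4 := Rmin_r x0 (cosine u0)).
  assert (m5 : 0 < Rmin k1 (Rmin x0 (cosine u0))) by (repeat apply Rmin_glb_lt; lra).
  unfold k. lra. }
clearbody k. destruct hk as [hk [hkk1 [hkx hku]]].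
set (m := sqrt (1 - k ^ 2)). assert (hm : 0 <= m) by apply sqrt_pos.
set (c := clip (- m) m).
assert (hc : forall y, -1 < c y < 1 /\ k <= cosine (c y)).
{ intros y. apply cosine_ge; [exact hk|]. apply clip_in. fold m. lra. }
set (L1 := 2 / k ^ 3). assert (hL1 : 0 < L1) by (apply Rdiv_lt_0_compat; [lra | apply pow_lt; lra]).
set (L := (INR p + 1) * (1 + L1)). set (B := (INR p + 1) * (b + / k)).
assert (hik : 0 < / k) by (apply Rinv_0_lt_compat; lra).
assert (hL : L1 <= L) by (unfold L; nra).
assert (hrho : forall x, k <= Rmax x k) by (intros; apply Rmax_r).
destruct (picard (fun t x y => - (c y / cosine (c y)))
  (fun t x y => (INR p + 1) * (clip a b t - cosine (c y) / Rmax x k)) L B b x0 u0)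
  as [X [Y [hX [hY hd]]]].
- lra.
- unfold B. nra.
- intros t x y t' x' y'.
  replace (- (c y / cosine (c y)) - - (c y' / cosine (c y')))
    with (- (c y / cosine (c y) - c y' / cosine (c y'))) by ring. rewrite Rabs_Ropp.
  destruct (field_lipschitz k (c y) (c y') (Rmax x k) (Rmax x' k) hk (proj1 (hc y)) (proj1 (hc y'))
    (proj2 (hc y)) (proj2 (hc y')) (hrho x) (hrho x')) as [l _]. fold L1 in l.
  assert (h1 := clip_lipschitz (- m) m y y'). fold c in h1.
  assert (q1 := Rabs_pos (t - t')). assert (q2 := Rabs_pos (x - x')). assert (q3 := Rabs_pos (c y - c y')).
  eapply Rle_trans; [exact l|]. apply Rmult_le_compat; lra.
- intros t x y t' x' y'.
  replace ((INR p + 1) * (clip a b t - cosine (c y) / Rmax x k) - (INR p + 1) * (clip a b t' - cosine (c y') / Rmax x' k))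
    with ((INR p + 1) * ((clip a b t - clip a b t') - (cosine (c y) / Rmax x k - cosine (c y') / Rmax x' k))) by ring.
  rewrite Rabs_mult, (Rabs_pos_eq (INR p + 1)) by lra.
  destruct (field_lipschitz k (c y) (c y') (Rmax x k) (Rmax x' k) hk (proj1 (hc y)) (proj1 (hc y'))
    (proj2 (hc y)) (proj2 (hc y')) (hrho x) (hrho x')) as [_ l]. fold L1 in l.
  assert (h1 := clip_lipschitz (- m) m y y'). fold c in h1.
  assert (h2 := clip_lipschitz a b t t'). assert (h3 := Rmax_lipschitz k x x').
  assert (q1 := Rabs_pos (t - t')). assert (q2 := Rabs_pos (x - x')). assert (q3 := Rabs_pos (y - y')).
  unfold L. rewrite Rmult_assoc. apply Rmult_le_compat_l; [lra|].
  eapply Rle_trans; [apply (Rabs_triang _ (- _))|]. rewrite Rabs_Ropp.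
  assert (h4 : L1 * (Rabs (c y - c y') + Rabs (Rmax x k - Rmax x' k)) <= L1 * (Rabs (y - y') + Rabs (x - x'))).
  { apply Rmult_le_compat_l; lra. }
  assert (h5 : 0 <= L1 * Rabs (t - t')) by nra. lra.
- intros t x y. destruct (hc y) as [hc1 hc2]. destruct (cosine_props _ hc1) as [hc3 _].
  rewrite Rabs_Ropp. unfold Rdiv.
  assert (h1 : Rabs (c y * / cosine (c y)) <= 1 * / k).
  { apply Rabs_mult_le; [apply Rabs_le; lra|].
    rewrite Rabs_pos_eq by (apply Rlt_le, Rinv_0_lt_compat; lra). apply Rinv_le_contravar; lra. }
  unfold B. nra.
- intros t x y. destruct (hc y) as [hc1 hc2]. destruct (cosine_props _ hc1) as [hc3 _].
  rewrite Rabs_mult, (Rabs_pos_eq (INR p + 1)) by lra. unfold B. apply Rmult_le_compat_l; [lra|].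
  assert (h1 := clip_in a b t (proj2 hab)). assert (h2 := hrho x).
  assert (h3 : 0 <= cosine (c y) / Rmax x k) by (apply Rdiv_le_0_compat; lra).
  assert (h4 : cosine (c y) / Rmax x k <= / k).
  { apply div_le_intro; [lra|]. apply Rle_trans with (/ k * k); [rewrite Rinv_l; lra|].
    apply Rmult_le_compat_l; lra. }
  apply Rabs_le. lra.
- assert (hprof : forall z, a <= z <= b -> k <= X z -> - m <= Y z <= m -> profile p X Y z).
  { intros z hz hXz hYz. destruct (hd z) as [d1 d2]. unfold c in d1, d2.
    rewrite (clip_id (- m) m (Y z) hYz) in d1, d2.
    rewrite (clip_id a b z hz), (Rmax_left (X z) k hXz) in d2.
    split; [lra|]. split; [apply (cosine_ge k _ hk hYz)|]. split; assumption. }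
  assert (cX : forall z, continuity_pt X z).
  { intros z. apply derivable_continuous_pt. eexists. apply is_derive_Reals, (hd z). }
  assert (cY : forall z, continuity_pt Y z).
  { intros z. apply derivable_continuous_pt. eexists. apply is_derive_Reals, (hd z). }
  assert (hm2 : m ^ 2 = 1 - k ^ 2) by (apply pow2_sqrt; nra).
  exists X, Y. split; [exact hX|]. split; [exact hY|].
  assert (bar : forall z, a <= z <= b -> 0 < X z - k /\ 0 < m ^ 2 - Y z ^ 2).
  { apply (backward_barrier (fun z => X z - k) (fun z => m ^ 2 - Y z ^ 2)); [lra | | | | |].
    - intros z. apply continuity_pt_minus; [apply cX | apply continuity_pt_const; intros ? ?; reflexivity].
    - intros z. apply continuity_pt_minus; [apply continuity_pt_const; intros ? ?; reflexivity|].
      apply (continuity_pt_comp Y (fun y => y ^ 2)); [apply cY|].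
      apply derivable_continuous_pt, derivable_pt_pow.
    - rewrite hX. lra.
    - rewrite hY. assert (h := lt_sqrt_of_cosine k u0 hk hu0 hku). fold m in h. nra.
    - intros s hs hz.
      assert (hprof' : forall z, s <= z <= b -> profile p X Y z).
      { intros z hzs. destruct (hz z hzs). apply hprof; [lra | lra | nra]. }
      assert (hFs := flux_decr p X Y s b (proj2 hs) hprof').
      destruct (hreg X Y s (proj1 hs) (hprof' s ltac:(lra))) as [g1 g2].
      { unfold flux in hFs at 1. rewrite hX, hY in hFs. exact hFs. }
      split; [lra|].
      destruct (hprof' s ltac:(lra)) as [_ [hu _]].
      assert (h := lt_sqrt_of_cosine k (Y s) hk hu ltac:(lra)). fold m in h. nra. }
  intros z hz. destruct (bar z hz). apply hprof; [exact hz | lra | nra].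
Qed.

(** * Shooting from infinity *)

(** At the cylinder the second factor in [flux_split] is [1/(p+2)]. The height condition makes the
    deviation, at most [(1+K) z^-3], cost no more than half of it; [7/8] is the lower bound for
    [z r] from [near_bounds]. The result depends on [z], [p] only and so is common to all shots. *)
Lemma near_flux_lower (p : nat) (K : R) (r u : R -> R) (z : R) : 0 <= K ->
  8 + 8 * K + 2 * (INR p + 2) * (1 + K) <= z -> 0 < r z -> near K r u z ->
  (7 / (8 * z)) ^ S p / (2 * (INR p + 2)) <= flux p r u z.
Proof.
intros hK hz hr [n1 n2]. assert (hp := pos_INR p).
assert (hq : 0 <= (INR p + 2) * (1 + K)) by nra.
assert (hw : 0 < / z <= 1 / 8).
{ split; [apply Rinv_0_lt_compat; lra|]. replace (/ z) with (1 / z) by (field; lra).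
  apply div_le_intro; lra. }
assert (hKw : K * / z <= 1 / 8) by (apply (div_le_intro K); lra).
replace (K / z ^ 3) with (K * (/ z) ^ 3) in n1, n2 by (field; lra).
replace (/ z ^ 2) with ((/ z) ^ 2) in n2 by (field; lra).
destruct (near_bounds K _ _ _ hK hw hKw n1 n2) as [bx [_ [_ [bc _]]]].
apply Rabs_le_between in n1. rewrite flux_split.
assert (hw3 : (1 + K) * (/ z) ^ 3 <= / (2 * (INR p + 2))).
{ replace ((1 + K) * (/ z) ^ 3) with ((1 + K) * / z * (/ z) ^ 2) by ring.
  assert (h1 : (1 + K) / z <= / (2 * (INR p + 2))).
  { apply div_le_intro; [lra|]. apply (Rmult_le_reg_l (2 * (INR p + 2))); [lra|].
    rewrite <- Rmult_assoc, Rinv_r by lra. lra. }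
  assert (h2 : (/ z) ^ 2 <= 1) by nra. assert (h3 : 0 <= (1 + K) * / z) by nra.
  unfold Rdiv in h1. nra. }
assert (hg : / (2 * (INR p + 2)) <= cosine (u z) - (INR p + 1) / (INR p + 2) * (z * r z)).
{ assert (hk : (INR p + 1) / (INR p + 2) = 1 - 2 * / (2 * (INR p + 2))) by (field; lra).
  assert (hi : 0 < / (2 * (INR p + 2)) <= 1 / 4).
  { split; [apply Rinv_0_lt_compat; lra|]. replace (/ (2 * (INR p + 2))) with (1 / (2 * (INR p + 2))) by (field; lra).
    apply div_le_intro; lra. }
  rewrite hk. revert hw3 hi. generalize (/ (2 * (INR p + 2))). intros q hw3 hi.
  assert (0 <= K * (/ z) ^ 3) by (assert (0 <= (/ z) ^ 3) by (apply pow_le; lra); nra).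
  assert ((1 - 2 * q) * (z * r z) <= (1 - 2 * q) * (1 + K * (/ z) ^ 3)) by (apply Rmult_le_compat_l; lra).
  nra. }
unfold Rdiv at 1. apply Rmult_le_compat.
- apply pow_le. apply Rdiv_le_0_compat; lra.
- apply Rlt_le, Rinv_0_lt_compat; lra.
- apply pow_incr. split; [apply Rdiv_le_0_compat; lra|]. apply div_le_intro; [lra|]. nra.
- exact hg.
Qed.

Lemma is_lim_seq_harmonic (C Z : R) : is_lim_seq (fun n => C / (INR n + Z)) 0.
Proof.
replace (Finite 0) with (Rbar_mult C 0) by (simpl; f_equal; ring).
apply is_lim_seq_scal_l.
apply (is_lim_seq_inv (fun n => INR n + Z) p_infty); [|discriminate].
apply (is_lim_seq_plus _ _ p_infty Z); [apply is_lim_seq_INR | apply is_lim_seq_const | reflexivity].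
Qed.

Lemma le_of_le_add_seq (e : nat -> R) (x y : R) (N : nat) : is_lim_seq e 0 ->
  (forall n, (N <= n)%nat -> x <= y + e n) -> x <= y.
Proof.
intros he h. apply Rnot_lt_le. intros hlt.
destruct (proj2 (is_lim_seq_spec e 0) he (mkposreal (x - y) ltac:(lra))) as [N1 h1].
simpl in h1. specialize (h1 (N + N1)%nat ltac:(lia)). specialize (h (N + N1)%nat ltac:(lia)).
rewrite Rminus_0_r in h1. apply Rabs_lt_between in h1. lra.
Qed.

(* Any two of the solutions are [O(b^-5)]-close at the smaller starting height [b],
   and [energy_mono] and [backward_gronwall] carry this down to [a]. *)
Lemma shooting_cauchy (p : nat) (K Z Z' : R) (X U : nat -> R -> R) (a T : R) :
  0 <= K -> INR p + 3 <= Z ->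
  (forall (r1 u1 r2 u2 : R -> R) (a b : R), Z' <= a <= b ->
    (forall z, a <= z <= b -> profile p r1 u1 z /\ profile p r2 u2 z /\
      near K r1 u1 z /\ near K r2 u2 z) ->
    a * energy p r1 u1 r2 u2 a <= b * energy p r1 u1 r2 u2 b) ->
  (forall n z, / (INR n + 1) <= z <= INR n + Z -> profile p (X n) (U n) z) ->
  (forall n z, Z <= z <= INR n + Z -> near K (X n) (U n) z) ->
  0 < a <= T -> Z <= T -> Z' <= T -> 8 + 8 * K + 2 * (INR p + 2) * (1 + K) <= T ->
  exists k C N, 0 < k <= 1 /\ 0 <= C /\ forall n z, (N <= n)%nat -> a <= z <= T ->
    profile p (X n) (U n) z /\ k <= cosine (U n z) /\ k <= X n z /\
    forall j, Rabs (X (n + j)%nat z - X n z) <= C / (INR n + Z) /\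
              Rabs (U (n + j)%nat z - U n z) <= C / (INR n + Z).
Proof.
intros hK hZ hmono hpr hnear ha hT1 hT2 hT3. assert (hp := pos_INR p).
set (f := (7 / (8 * T)) ^ S p / (2 * (INR p + 2))).
assert (hf : 0 < f).
{ apply Rdiv_lt_0_compat; [|lra]. apply pow_lt, Rdiv_lt_0_compat; lra. }
destruct (region_bound p a f (proj1 ha) hf) as [k [hk hreg]].
destruct (INR_unbounded (T + / a)) as [N hN].
assert (hia : 0 < / a) by (apply Rinv_0_lt_compat; lra).
assert (big : forall n, (N <= n)%nat -> T <= INR n + Z /\ / (INR n + 1) <= a).
{ intros n hn. assert (h := le_INR _ _ hn). split; [lra|].
  rewrite <- (Rinv_inv a). apply Rinv_le_contravar; lra. }
assert (prof : forall n z, (N <= n)%nat -> a <= z <= T -> profile p (X n) (U n) z).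
{ intros n z hn hz. destruct (big n hn). apply hpr; lra. }
assert (reg : forall n z, (N <= n)%nat -> a <= z <= T -> k <= cosine (U n z) /\ k <= X n z).
{ intros n z hn hz. destruct (big n hn) as [hb _].
  apply (hreg (X n) (U n) z (proj1 hz) (prof n z hn hz)).
  apply Rle_trans with (flux p (X n) (U n) T).
  - apply (near_flux_lower p K); [exact hK | exact hT3 | apply (prof n T hn); lra | apply hnear; lra].
  - apply flux_decr; [lra|]. intros y hy. apply prof; [exact hn | lra]. }
set (G := exp (4 * (INR p + 1) * (2 / k ^ 3) * (T - a))). assert (hG : 0 < G) by apply exp_pos.
set (C0 := 4 * (INR p + 2) * K ^ 2). assert (hC0 : 0 <= C0) by (unfold C0; nra).
exists k, (1 + G * C0), N. split; [exact hk|].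
assert (hGC : 0 <= G * C0) by nra.
split; [lra|].
intros n z hn hz. split; [exact (prof n z hn hz)|]. destruct (reg n z hn hz) as [g1 g2].
split; [exact g1|]. split; [exact g2|]. intros j.
set (b := INR n + Z). destruct (big n hn) as [hb1 hb2]. fold b in hb1.
assert (hj : (N <= n + j)%nat) by lia.
assert (hnj : b <= INR (n + j) + Z) by (unfold b; rewrite plus_INR; assert (h := pos_INR j); lra).
assert (hE : T * energy p (X (n + j)%nat) (U (n + j)%nat) (X n) (U n) T <= C0 / b ^ 5).
{ eapply Rle_trans.
  - apply (hmono _ _ _ _ T b); [lra|]. intros y hy.
    destruct (big _ hj) as [_ h2].
    split; [apply hpr; lra|]. split; [apply hpr; fold b; lra|]. split; apply hnear; fold b; lra.
  - apply near_energy_le; [exact hK | lra | |]; apply hnear; fold b; lra. }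
assert (hD := energy_ge p (X (n + j)%nat) (U (n + j)%nat) (X n) (U n) T ltac:(lra)).
assert (hg := backward_gronwall p k (X (n + j)%nat) (U (n + j)%nat) (X n) (U n) z T hk (proj2 hz)
  (fun y hy => conj (prof _ y hj ltac:(lra)) (conj (prof _ y hn ltac:(lra))
    (conj (proj1 (reg _ y hj ltac:(lra))) (conj (proj1 (reg _ y hn ltac:(lra)))
      (conj (proj2 (reg _ y hj ltac:(lra))) (proj2 (reg _ y hn ltac:(lra)))))))) ).
assert (hk3 : 0 < 2 / k ^ 3) by (apply Rdiv_lt_0_compat; [lra | apply pow_lt; lra]).
assert (hGz : exp (4 * (INR p + 1) * (2 / k ^ 3) * (T - z)) <= G).
{ apply exp_mono. apply Rmult_le_compat_l; [nra | lra]. }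
(* The exponent 2 is enough: its square root is the rate [1 / b], which tends to 0. *)
assert (hb5 : C0 / b ^ 5 <= C0 / b ^ 2).
{ apply Rmult_le_compat_l; [exact hC0|]. apply Rinv_le_contravar; [apply pow_lt; lra|].
  apply Rle_pow; [lra | lia]. }
assert (hfin : (X (n + j)%nat z - X n z) ^ 2 + (U (n + j)%nat z - U n z) ^ 2 <= ((1 + G * C0) / b) ^ 2).
{ eapply Rle_trans; [exact hg|].
  apply Rle_trans with (G * (C0 / b ^ 2)).
  - apply Rmult_le_compat; [apply Rlt_le, exp_pos | | exact hGz | lra].
    apply Rplus_le_le_0_compat; apply pow2_ge_0.
  - replace (G * (C0 / b ^ 2)) with (G * C0 * / b ^ 2) by (field; lra).
    replace (((1 + G * C0) / b) ^ 2) with ((1 + G * C0) ^ 2 * / b ^ 2) by (field; lra).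
    apply Rmult_le_compat_r; [apply Rlt_le, Rinv_0_lt_compat, pow_lt; lra | nra]. }
assert (hpos : 0 <= (1 + G * C0) / b) by (apply Rdiv_le_0_compat; lra).
assert (s1 := pow2_ge_0 (X (n + j)%nat z - X n z)). assert (s2 := pow2_ge_0 (U (n + j)%nat z - U n z)).
split; apply Rabs_le_of_sq; lra.
Qed.

Lemma exists_profile (p : nat) : exists r u : R -> R, forall z, 0 < z -> profile p r u z.
Proof.
destruct (near_terminal p) as [K [Z [hK [hZ hnear]]]].
destruct (energy_mono p K hK) as [Z' [hZ' hmono]]. assert (hp := pos_INR p).
(* The intervals [[1/(n+1), n+Z]] exhaust the half-line, so every fixed height is eventually
   covered. *)
assert (hex : forall n : nat, exists XU : (R -> R) * (R -> R),
  (INR n + Z) * fst XU (INR n + Z) = 1 /\ snd XU (INR n + Z) = / (INR n + Z) ^ 2 /\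
  forall z, / (INR n + 1) <= z <= INR n + Z -> profile p (fst XU) (snd XU) z).
{ intros n. assert (hn := pos_INR n). set (b := INR n + Z).
  assert (hb : INR p + 3 <= b) by (unfold b; lra).
  assert (hb2 : 0 < / b ^ 2 < 1).
  { split; [apply Rinv_0_lt_compat, pow_lt; lra|].
    rewrite <- Rinv_1. apply Rinv_lt_contravar; nra. }
  destruct (profile_backward p (/ (INR n + 1)) b (/ b) (/ b ^ 2)) as [r [u [hr [hu hs]]]].
  - split; [apply Rinv_0_lt_compat; lra|]. apply Rle_trans with 1; [|lra].
    rewrite <- Rinv_1. apply Rinv_le_contravar; lra.
  - apply Rinv_0_lt_compat; lra.
  - lra.
  - apply flux_pos_terminal; [exact hb | field; lra | reflexivity].
  - exists (r, u). simpl fst. simpl snd. split; [rewrite hr; field; lra|]. split; assumption. }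
apply functional_choice in hex. destruct hex as [XU hXU].
set (X := fun n => fst (XU n)). set (U := fun n => snd (XU n)).
assert (hpr : forall n z, / (INR n + 1) <= z <= INR n + Z -> profile p (X n) (U n) z).
{ intros n. apply (hXU n). }
assert (hnr : forall n z, Z <= z <= INR n + Z -> near K (X n) (U n) z).
{ intros n. assert (hn := pos_INR n). destruct (hXU n) as [h1 [h2 h3]].
  apply hnear; [lra | exact h1 | exact h2|]. intros z hz. apply hpr. split; [|lra].
  apply Rle_trans with 1; [|lra]. rewrite <- Rinv_1. apply Rinv_le_contravar; lra. }
set (r := fun z => real (Lim_seq (fun n => X n z))).
set (u := fun z => real (Lim_seq (fun n => U n z))).
exists r, u. intros z hz.
set (Zb := 8 + 8 * K + 2 * (INR p + 2) * (1 + K)).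
assert (hZb : 0 <= Zb) by (unfold Zb; nra).
(* The summand [2 * z] puts the ball of radius [z / 2] around [z] inside [[z/2, T]], where the
   Cauchy estimate holds. *)
set (T := Z + Z' + Zb + 2 * z).
destruct (shooting_cauchy p K Z Z' X U (z / 2) T hK hZ hmono hpr hnr
  ltac:(unfold T; lra) ltac:(unfold T; lra) ltac:(unfold T; lra) ltac:(fold Zb; unfold T; lra))
  as [k [C [N [hk [hC hall]]]]].
set (e := fun n => C / (INR n + Z)).
assert (he0 : forall n, 0 <= e n) by (intros n; assert (hn := pos_INR n); apply Rdiv_le_0_compat; lra).
assert (he : is_lim_seq e 0) by apply is_lim_seq_harmonic.
assert (lX : forall n y, (N <= n)%nat -> z / 2 <= y <= T -> Rabs (X n y - r y) <= e n).
{ intros n y hn hy. apply (cauchy_rate (fun n => X n y) e N he); [|exact hn].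
  intros m j hm. apply (hall m y hm hy). }
assert (lU : forall n y, (N <= n)%nat -> z / 2 <= y <= T -> Rabs (U n y - u y) <= e n).
{ intros n y hn hy. apply (cauchy_rate (fun n => U n y) e N he); [|exact hn].
  intros m j hm. apply (hall m y hm hy). }
(* Halving gives the strict inequality that [lt_sqrt_of_cosine] needs for each [U n]; the resulting
   interval for [U n] passes to the limit in closed form. *)
set (k' := k / 2). assert (hk' : 0 < k' <= 1) by (unfold k'; lra).
assert (hreg : forall y, z / 2 <= y <= T -> -1 < u y < 1 /\ k' <= cosine (u y) /\ k' <= r y).
{ intros y hy.
  assert (h1 : k <= r y).
  { apply (le_of_le_add_seq e _ _ N he). intros n hn.
    destruct (hall n y hn hy) as [_ [_ [h _]]]. assert (h2 := lX n y hn hy).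
    apply Rabs_le_between in h2. lra. }
  assert (h2 : forall n, (N <= n)%nat -> - sqrt (1 - k' ^ 2) < U n y < sqrt (1 - k' ^ 2)).
  { intros n hn. destruct (hall n y hn hy) as [[_ [h3 _]] [h4 _]].
    apply lt_sqrt_of_cosine; [exact hk' | exact h3 | unfold k'; lra]. }
  destruct (cosine_ge k' (u y) hk') as [h3 h4].
  - split; apply (le_of_le_add_seq e _ _ N he); intros n hn; specialize (h2 n hn);
      assert (h5 := lU n y hn hy); apply Rabs_le_between in h5; lra.
  - split; [exact h3|]. split; [exact h4 | unfold k'; lra]. }
set (L := 2 / k' ^ 3). assert (hL : 0 < L) by (apply Rdiv_lt_0_compat; [lra | apply pow_lt; lra]).
assert (hlip : forall n y, (N <= n)%nat -> z / 2 <= y <= T ->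
  Rabs (U n y / cosine (U n y) - u y / cosine (u y)) <= 2 * L * e n /\
  Rabs (cosine (U n y) / X n y - cosine (u y) / r y) <= 2 * L * e n).
{ intros n y hn hy. destruct (hall n y hn hy) as [[_ [h1 _]] [h2 [h3 _]]].
  destruct (hreg y hy) as [h4 [h5 h6]].
  destruct (field_lipschitz k' (U n y) (u y) (X n y) (r y) hk' h1 h4 ltac:(unfold k'; lra) h5
    ltac:(unfold k'; lra) h6) as [l1 l2]. fold L in l1, l2.
  assert (h7 := lX n y hn hy). assert (h8 := lU n y hn hy). assert (h9 := he0 n).
  assert (h10 := Rabs_pos (U n y - u y)). assert (h11 := Rabs_pos (X n y - r y)).
  split.
  - eapply Rle_trans; [exact l1|].
    replace (2 * L * e n) with (L * (2 * e n)) by ring. apply Rmult_le_compat_l; lra.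
  - eapply Rle_trans; [exact l2|].
    replace (2 * L * e n) with (L * (2 * e n)) by ring. apply Rmult_le_compat_l; lra. }
(* One multiple of [e] dominates the errors of the functions and of both right-hand sides. *)
set (A := 1 + (INR p + 1) * (2 * L)).
assert (hAe : is_lim_seq (fun n => A * e n) 0).
{ replace (Finite 0) with (Rbar_mult A 0) by (simpl; f_equal; ring). apply is_lim_seq_scal_l, he. }
assert (hAn : forall n, e n <= A * e n /\ 2 * L * e n <= A * e n /\ (INR p + 1) * (2 * L * e n) <= A * e n).
{ intros n. assert (h := he0 n). assert (h1 : 0 <= L * e n) by nra.
  assert (h2 : 0 <= INR p * (L * e n)) by nra. unfold A. repeat split; nra. }
assert (hd2 : 0 < z / 2) by lra.
assert (hball : forall y, Rabs (y - z) < mkposreal (z / 2) hd2 -> z / 2 <= y <= T).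
{ intros y hy. simpl in hy. apply Rabs_lt_between in hy. unfold T. lra. }
destruct (hreg z ltac:(unfold T; lra)) as [hu [_ hr]].
split; [lra|]. split; [exact hu|]. split.
- apply (derive_limit X (fun n y => - (U n y / cosine (U n y))) r (fun y => - (u y / cosine (u y))) z
    (mkposreal _ hd2) (fun n => A * e n) N hAe).
  intros n y hn hy. apply hball in hy. destruct (hall n y hn hy) as [[_ [_ [d _]]] _].
  destruct (hlip n y hn hy) as [l _]. destruct (hAn n) as [a1 [a2 _]].
  split; [exact d|]. split; [apply Rle_trans with (1 := lX n y hn hy), a1|].
  replace (- (U n y / cosine (U n y)) - - (u y / cosine (u y)))
    with (- (U n y / cosine (U n y) - u y / cosine (u y))) by ring.
  rewrite Rabs_Ropp. lra.
- apply (derive_limit U (fun n y => (INR p + 1) * (y - cosine (U n y) / X n y)) u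
    (fun y => (INR p + 1) * (y - cosine (u y) / r y)) z
    (mkposreal _ hd2) (fun n => A * e n) N hAe).
  intros n y hn hy. apply hball in hy. destruct (hall n y hn hy) as [[_ [_ [_ d]]] _].
  destruct (hlip n y hn hy) as [_ l]. destruct (hAn n) as [a1 [_ a3]].
  split; [exact d|]. split; [apply Rle_trans with (1 := lU n y hn hy), a1|].
  replace ((INR p + 1) * (y - cosine (U n y) / X n y) - (INR p + 1) * (y - cosine (u y) / r y))
    with ((INR p + 1) * - (cosine (U n y) / X n y - cosine (u y) / r y)) by ring.
  rewrite Rabs_mult, Rabs_Ropp, (Rabs_pos_eq (INR p + 1)) by lra.
  apply Rle_trans with (2 := a3). apply Rmult_le_compat_l; lra.
Qed.

(** * Return to theta and conclusion *)

Lemma cosine_sin (t : R) : - (PI / 2) < t < PI / 2 -> cosine (sin t) = cos t /\ -1 < sin t < 1.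
Proof.
intros ht. assert (hc : 0 < cos t) by (apply cos_gt_0; lra).
assert (h2 := sin2_cos2 t). unfold Rsqr in h2. split; [|nra].
unfold cosine. replace (1 - sin t ^ 2) with (cos t ^ 2) by lra.
apply sqrt_pow2. lra.
Qed.

Lemma profile_of_capillary (p : nat) (r theta : R -> R) : capillary_solution (S (S p)) r theta ->
  forall z, 0 < z -> profile p r (fun x => sin (theta x)) z.
Proof.
intros hs z hz. destruct (hs z hz) as [hr [ht [dr dt]]].
destruct (cosine_sin (theta z) ltac:(lra)) as [hc hu].
assert (hc0 : 0 < cos (theta z)) by (apply cos_gt_0; lra).
split; [exact hr|]. split; [exact hu|]. rewrite hc. split; [exact dr|].
auto_derive; [eexists; exact dt|]. derive_val dt. rewrite !S_INR. field. lra.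
Qed.

Lemma is_derive_asin (x : R) : -1 < x < 1 -> is_derive asin x (1 / cosine x).
Proof.
intros hx. apply is_derive_Reals.
replace (cosine x) with (sqrt (1 - x²)) by (unfold cosine, Rsqr; f_equal; ring).
rewrite <- (derive_pt_asin x hx). apply derive_pt_eq_1 with (derivable_pt_asin x hx). reflexivity.
Qed.

Lemma capillary_of_profile (p : nat) (r u : R -> R) : (forall z, 0 < z -> profile p r u z) ->
  capillary_solution (S (S p)) r (fun z => asin (u z)).
Proof.
intros hs z hz. destruct (hs z hz) as [hr [hu [dr du]]].
destruct (cosine_props _ hu) as [hc _].
assert (hsin : sin (asin (u z)) = u z) by (apply sin_asin; lra).
assert (hcos : cos (asin (u z)) = cosine (u z)).
{ rewrite cos_asin by lra. unfold cosine. f_equal. unfold Rsqr. ring. }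
split; [exact hr|]. split; [apply asin_bound_lt, hu|]. split.
- unfold tan. rewrite hsin, hcos. exact dr.
- rewrite hcos. assert (da := is_derive_comp asin u z _ _
    (is_derive_asin _ hu) du).
  eapply is_derive_ext_val; [|exact da].
  change scal with Rmult. cbv beta. rewrite !S_INR. field. lra.
Qed.

Theorem theorem1 (n : nat) (hn : (2 <= n)%nat) :
  exists r theta : R -> R,
    capillary_solution n r theta /\
    (forall r' theta' : R -> R, capillary_solution n r' theta' ->
       forall z : R, 0 < z -> r' z = r z /\ theta' z = theta z) /\
    is_lim (fun z => z * r z) p_infty 1 /\
    is_lim theta p_infty 0.
Proof.
destruct n as [|[|p]]; [lia | lia |]. clear hn.
destruct (exists_profile p) as [r [u hs]].
exists r, (fun z => asin (u z)).
split; [exact (capillary_of_profile p r u hs)|]. split.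
{ intros r' theta' h' z hz. assert (hs' := profile_of_capillary p r' theta' h').
  destruct (profile_unique p _ _ _ _ hs' hs z hz) as [h1 h2]. split; [exact h1|].
  (* Equality of the sines determines theta, which lies in [(-PI/2, PI/2)]. *)
  simpl in h2. rewrite <- h2, asin_sin; [reflexivity|]. destruct (h' z hz) as [_ [ht _]]. lra. }
destruct (near_global p) as [K [Z [hK [hZ hnear]]]].
(* The constant [K + 1] leaves room for the centre [z^-2] of [u] next to the error [K / z^3]. *)
assert (hlim : forall f l, (forall z, Z <= z -> Rabs (f z - l) <= (K + 1) / z) -> is_lim f p_infty l).
{ intros f l h. apply is_lim_spec. intros eps.
  exists (Z + (K + 1) / eps). intros z hz.
  assert (he := cond_pos eps). assert (h0 : 0 < (K + 1) / eps) by (apply Rdiv_lt_0_compat; lra).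
  eapply Rle_lt_trans; [apply h; lra|].
  apply (Rmult_lt_reg_r z); [lra|]. replace ((K + 1) / z * z) with (eps * ((K + 1) / eps)) by (field; lra).
  apply Rmult_lt_compat_l; lra. }
assert (hpow : forall z k, Z <= z -> / z ^ S k <= / z).
{ intros z k hz. apply Rinv_le_contravar; [lra|].
  assert (h := Rle_pow z 1 (S k) ltac:(lra) ltac:(lia)). lra. }
split.
- apply hlim. intros z hz. destruct (hnear r u hs z hz) as [h1 _].
  assert (h3 := hpow z 2%nat hz). assert (h4 : 0 < / z) by (apply Rinv_0_lt_compat; lra).
  eapply Rle_trans; [exact h1|]. unfold Rdiv.
  apply Rle_trans with (K * / z); [apply Rmult_le_compat_l; lra | nra].
- assert (hu : is_lim u p_infty 0).
  { apply hlim. intros z hz. destruct (hnear r u hs z hz) as [_ h2].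
    assert (h3 := hpow z 2%nat hz). assert (h5 := hpow z 1%nat hz).
    assert (h4 : 0 < / z) by (apply Rinv_0_lt_compat; lra).
    assert (h6 : 0 < / z ^ 2) by (apply Rinv_0_lt_compat, pow_lt; lra).
    assert (h7 : K / z ^ 3 <= K * / z) by (apply Rmult_le_compat_l; lra).
    apply Rabs_le_between in h2. apply Rabs_le. unfold Rdiv in *. lra. }
  rewrite <- asin_0. apply (is_lim_comp_continuous u asin p_infty 0 hu).
  apply (ex_derive_continuous (V := R_NormedModule)). eexists.
  apply is_derive_asin. lra.
Qed.
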